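(* Let $X$ be a finite qc-reducible $T_0$-space of height $2$ and let $a\in X$ be a maximal point such that the subspace $X\smallsetminus\{a\}$ is connected. Then $X\smallsetminus\{a\}$ is aspherical.
   Context: All finite spaces are finite topological spaces satisfying the $T_0$ axiom. A finite $T_0$-space $X$ is identified with a finite poset: $x\le y$ iff $x$ belongs to every open set containing $y$; the sets $U_x=\{y\in X: y\le x\}$ form a basis of the topology. All topological notions (connected, contractible, homotopy groups) refer to this topology. A finite space is connected iff it is path connected. Subsets carry the subspace topology (equivalently, the induced order). The height of $X$ is the maximum length of its chains, where the chain $x_0<x_1<\cdots<x_n$ has length $n$. qc-reduction: let $X$ be a finite space of height $2$ and let $a,b\in X$ be two (distinct) maximal points such that $U_a\cup U_b$ is contractible. Let $Y=X\cup\{c\}$, where $c$ is a new point with $a,b<c$ (so the elements of $Y$ strictly below $c$ are exactly those of $U_a\cup U_b$). Then there is a qc-reduction from $X$ to $Y\smallsetminus\{a,b\}$. A finite space of height $2$ is qc-reducible if one can obtain from it a space with a maximum by performing a (finite) sequence of qc-reductions. A path connected space $X$ is aspherical if $\pi_n(X)$ is trivial for all $n\ge 2$. *)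

(* Defs.v *)
From HB Require Import structures.
From mathcomp Require Import all_boot all_order all_algebra.
From mathcomp Require Import all_classical all_reals all_analysis.
From Stdlib Require Import Relation_Operators.

Set Implicit Arguments.
Unset Strict Implicit.
Unset Printing Implicit Defensive.

Import Order.TTheory GRing.Theory Num.Theory.
Import numFieldNormedType.Exports.

Local Open Scope classical_set_scope.
Local Open Scope order_scope.

(* [fin_space X] is the finite T0-space corresponding to the finite poset X:
   its open sets are the down-sets of X, see [fin_space_leP]. *)
Definition fin_space {d} (X : finPOrderType d) : Type := X.

Section FinSpace.
Context {d : Order.disp_t} (X : finPOrderType d).

HB.instance Definition _ := Order.FinPOrder.on (fin_space X).

Definition fin_space_open (U : set (fin_space X)) :=
  forall x y : X, x <= y -> U y -> U x.

Let openT : fin_space_open setT.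
Proof. by []. Qed.

Let openI (U V : set (fin_space X)) :
  fin_space_open U -> fin_space_open V -> fin_space_open (U `&` V).
Proof. by move=> oU oV x y xy [Uy Vy]; split; [exact: oU Uy|exact: oV Vy]. Qed.

Let open_bigU (I : Type) (F : I -> set (fin_space X)) :
  (forall i, fin_space_open (F i)) -> fin_space_open (\bigcup_i F i).
Proof. by move=> oF x y xy [i _ Fy]; exists i => //; exact: oF Fy. Qed.

HB.instance Definition _ :=
  isOpenTopological.Build (fin_space X) openT openI open_bigU.

Definition minimal_open (a : X) : set (fin_space X) := [set y | y <= a].

Lemma fin_space_leP (x y : X) :
  x <= y <-> forall U : set (fin_space X), open U -> U y -> U x.
Proof.
split=> [xy U oU|Uxy]; first exact: oU.
apply: (Uxy (minimal_open y)); last exact: lexx.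
by move=> u v uv vy; exact: le_trans uv vy.
Qed.

Lemma fin_space_kolmogorov : kolmogorov_space (fin_space X).
Proof.
have openU z : open (minimal_open z).
  by move=> u v uv vz; exact: le_trans uv vz.
have nbhsU z : minimal_open z \in nbhs (z : fin_space X).
  by rewrite inE; apply: open_nbhs_nbhs; split; [exact: openU|exact: lexx].
move=> x y xy; case: (boolP (y <= x :> X)) => yx.
  exists (minimal_open y); right; split; first exact: nbhsU.
  rewrite inE => xley; move/eqP: xy; apply.
  by apply/le_anti/andP.
exists (minimal_open x); left; split; first exact: nbhsU.
by rewrite inE; apply/negP.
Qed.

Definition is_chain (C : {set X}) : bool :=
  [forall x in C, forall y in C, x >=< y].

(* A chain with n + 1 elements has length n. *)
Definition height : nat := (\max_(C : {set X} | is_chain C) #|C|.-1)%N.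

Definition maximal_point (a : X) := forall x : X, a <= x -> x = a.

Definition has_maximum := exists m : X, forall x : X, x <= m.

End FinSpace.

Section Homotopy.
Context (R : realType).
Local Open Scope ring_scope.

Definition contractible (T : topologicalType) :=
  exists (p : T) (H : R * T -> T),
    [/\ {within `[0, 1] `*` setT, continuous H},
        forall x, H (0, x) = x & forall x, H (1, x) = p].

Definition path_connected (T : topologicalType) :=
  forall x y : T, exists f : R -> T,
    [/\ {within `[0, 1], continuous f}, f 0 = x & f 1 = y].

Definition cube n : set 'rV[R]_n := [set u | forall i, 0 <= u ord0 i <= 1].

Definition cube_boundary n : set 'rV[R]_n :=
  [set u | cube u /\ exists i, u ord0 i = 0 \/ u ord0 i = 1].

Section HomotopyGroup.
Context (n : nat) (T : topologicalType) (x0 : T).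

(* Maps (I^n, bd I^n) -> (T, x0); values outside the cube are irrelevant. *)
Definition cube_map (f : 'rV[R]_n -> T) :=
  {within @cube n, continuous f} /\ forall u, cube_boundary u -> f u = x0.

Definition cube_homotopic (f g : 'rV[R]_n -> T) :=
  exists H : R * 'rV[R]_n -> T,
    [/\ {within `[0, 1] `*` @cube n, continuous H},
        forall u, cube u -> H (0, u) = f u,
        forall u, cube u -> H (1, u) = g u &
        forall (t : R) u, 0 <= t <= 1 -> cube_boundary u -> H (t, u) = x0].

Definition homotopy_class (f : 'rV[R]_n -> T) : set ('rV[R]_n -> T) :=
  [set g | cube_map g /\ cube_homotopic f g].

(* The underlying set of pi_n(T, x0); its neutral element is
   [homotopy_class (cst x0)]. *)
Definition homotopy_group : set (set ('rV[R]_n -> T)) :=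
  [set homotopy_class f | f in cube_map].

Definition trivial_homotopy_group :=
  homotopy_group = [set homotopy_class (cst x0)].

End HomotopyGroup.

Definition aspherical (T : topologicalType) :=
  path_connected T /\
  forall n (x0 : T), (2 <= n)%N -> trivial_homotopy_group n x0.

End Homotopy.

(* The poset X + {c}, with c encoded as [None], whose elements strictly below
   c are those of U_a and U_b. *)
Definition add_above {d} {X : finPOrderType d} (a b : X) : Type := option X.

Section AddAbove.
Context {d : Order.disp_t} {X : finPOrderType d} (a b : X).

HB.instance Definition _ := Finite.on (add_above a b).

Definition add_above_le (y z : add_above a b) : bool :=
  match y, z with
  | Some x, Some x' => x <= x'
  | Some x, None => (x <= a) || (x <= b)
  | None, Some _ => false
  | None, None => true
  end.

Let add_above_refl : reflexive add_above_le.
Proof. by case=> //= x; exact: lexx. Qed.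

Let add_above_anti : antisymmetric add_above_le.
Proof. by move=> [x|] [y|] //=; [move/le_anti=> ->|rewrite andbF]. Qed.

Let add_above_trans : transitive add_above_le.
Proof.
move=> [y|] [x|] [z|] //=; first exact: le_trans.
by move=> xy /orP[] /(le_trans xy) ->; rewrite ?orbT.
Qed.

HB.instance Definition _ :=
  Order.Le_isPOrder.Build d (add_above a b)
    add_above_refl add_above_anti add_above_trans.

End AddAbove.

Definition qc_space {d} {X : finPOrderType d} (a b : X) : Type :=
  {y : add_above a b | (y != Some a) && (y != Some b)}.

Section QcSpace.
Context {d : Order.disp_t} {X : finPOrderType d} (a b : X).

HB.instance Definition _ := SubFinite.on (qc_space a b).
HB.instance Definition _ :=
  [SubChoice_isSubPOrder of (qc_space a b) by <: with d].

End QcSpace.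

Variant qc_reduction (R : realType) d :
    finPOrderType d -> finPOrderType d -> Prop :=
  QcReduction (X : finPOrderType d) (a b : X) of
    height X = 2 & maximal_point a & maximal_point b & a != b &
    contractible R (set_type (minimal_open a `|` minimal_open b)) :
    qc_reduction R X (qc_space a b).

Definition qc_reducible (R : realType) d (X : finPOrderType d) :=
  height X = 2 /\
  exists2 Z : finPOrderType d,
    clos_refl_trans_1n (finPOrderType d) (@qc_reduction R d) X Z &
    has_maximum Z.

(* Main.v *)
Require Import Defs.
From HB Require Import structures.
From mathcomp Require Import all_boot all_order all_algebra.
From mathcomp Require Import all_classical all_reals all_analysis.
From mathcomp Require Import lra.
Set Implicit Arguments.
Unset Strict Implicit.
Unset Printing Implicit Defensive.
Import Order.TTheory GRing.Theory Num.Theory.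
Import numFieldNormedType.Exports.
Local Open Scope classical_set_scope.
Local Open Scope ring_scope.

(** In this file [U_c] stands for the set of points below [c] and [L_c] for the
    set of points strictly below [c].

    The complement of a maximal point [a] of a qc-reducible space has the
    homotopy of [L_a]. In height 2 the poset [L_a] has height at most 1, so it
    is a graph, and graphs are aspherical.

    To compare the complement of [a] with [L_a], follow the reductions. One
    that merges two points [b] and [b'] other than [a] replaces two cones by a
    single cone on the contractible set [U_b] u [U_b'], which does not change
    the homotopy of the complement of [a] ([sphere_null_merge]). One that
    merges [a] with [b] gives a new point [c] with [L_c] = [L_a] u [L_b], and
    the complement of [a] is the complement of [c] with a cone attached over
    [L_b]. By induction the complement of [c] is [L_c] up to homotopy, hence
    the complement of [a] is [L_a] u [U_b]; and [U_b] meets [L_a] in [U_a] n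
    [U_b], so attaching [U_b] to [L_a] is harmless once this intersection is
    contractible ([sphere_null_cone]). At the end of the sequence the space has
    a maximum [c] and its complement is equal to [L_c]. The induction is
    carried out for [X] lying in a larger poset, since the cone over [L_b] has
    to be carried along ([link_determines_complement], [qc_step_other],
    [qc_step_self]).

    That [U_a] n [U_b] is contractible whenever [U_a] u [U_b] is
    ([contractible_cap]) is combinatorial. A topological contraction of a
    finite space moves through finitely many order-preserving maps, so a
    contractible poset with more than one point has a beat point; and beat
    points of the union can be removed one at a time while keeping its shape.

    All maps into posets are handled through [lower_cont], and asphericity
    through [sphere_null]: every map from a sphere is freely homotopic to a
    constant. The only use of real analysis in the comparison is a Urysohn
    function ([push_off]), which lets a map into a poset avoid a closed set
    around which it takes values in a contractible set. For graphs
    ([graph_sphere_null]) a map defined on a vector space is lifted to the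
    universal cover, realised as the tree of reduced walks, and the walks are
    shortened one step at a time. *)

(** * Maps into posets and their homotopies *)

(** Continuity into a finite space, where the down-set of [f x] is the least
    neighbourhood of [f x]. The order is a mere relation, because it is also
    used on posets with an adjoined point and on walks. *)
Definition lower_cont_at (T : topologicalType) V (le : V -> V -> Prop)
    (f : T -> V) (x : T) := \forall y \near x, le (f y) (f x).

Definition lower_cont (T : topologicalType) V (le : V -> V -> Prop)
    (f : T -> V) := forall x, lower_cont_at le f x.

Lemma lower_cont_comp (S T : topologicalType) V (le : V -> V -> Prop)
    (g : S -> T) (f : T -> V) :
  continuous g -> lower_cont le f -> lower_cont le (f \o g).
Proof. by move=> cg cf x; exact: (cg x _ (cf (g x))). Qed.

Lemma lower_cont_cst (T : topologicalType) V (le : V -> V -> Prop) (v : V) :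
  le v v -> lower_cont le (fun=> v : V) (T := T).
Proof. by move=> vv x; apply: nearW. Qed.

Lemma lower_cont_near (T : topologicalType) V (le : V -> V -> Prop)
    (f g : T -> V) (x : T) :
  (\forall y \near x, g y = f y) -> lower_cont_at le f x ->
  lower_cont_at le g x.
Proof.
move=> fg cf; rewrite /lower_cont_at (nbhs_singleton fg).
by apply: filterS2 fg cf => y ->.
Qed.

(** Maps into posets are glued along a closed set [C] on which the new values
    dominate: a point of [C] may have neighbours on either side, a point off
    [C] does not see [C]. Lifting a map to higher values on a closed set is the
    source of all homotopies below. *)
Lemma lower_cont_if (T : topologicalType) V (le : V -> V -> Prop)
    (C : set T) (f g : T -> V) :
  closed C -> (forall x, ~ C x -> lower_cont_at le f x) ->
  (forall x, C x -> \forall y \near x,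
     (C y -> le (g y) (g x)) /\ (~ C y -> le (f y) (g x))) ->
  lower_cont le (fun x => if `[< C x >] then g x else f x).
Proof.
move=> clC cf cg x; have [Cx|nCx] := pselect (C x).
  rewrite /lower_cont_at (asboolT Cx); apply: filterS (cg x Cx) => y [h1 h2].
  by case: asboolP => [/h1|/h2].
apply: (@lower_cont_near _ _ _ f); last exact: cf.
apply: filterS (open_nbhs_nbhs (conj (closed_openC clC) nCx)) => y nCy.
by rewrite asboolF.
Qed.

Section Homotopies.
Context (R : realType) (V : Type) (le : V -> V -> Prop).
Hypothesis le_refl : forall v, le v v.
Hypothesis le_trans : forall u v w, le u v -> le v w -> le u w.

(** [K x] confines the track of [x]: a constant [K] bounds the image, and a [K]
    that depends on [x] prescribes boundary values. Time runs over the whole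
    line and the homotopy stands still outside of [t0, t1], so that homotopies
    are concatenated by a translation. *)
Definition homotopic (T : topologicalType) (K : T -> set V) (f g : T -> V) :=
  exists (F : R * T -> V) (t0 t1 : R),
    [/\ lower_cont le F, forall z, K z.2 (F z),
        forall t x, t <= t0 -> F (t, x) = f x &
        forall t x, t1 <= t -> F (t, x) = g x].

Context (T : topologicalType) (K : T -> set V).
Implicit Types f g h : T -> V.

Lemma continuous_fst_affine (a b : R) :
  continuous (fun z : R * T => (a * z.1 + b, z.2) : R * T).
Proof.
move=> z; apply: (@cvg_pair _ _ _ _ (nbhs (a * z.1 + b)) (nbhs z.2)).
  by apply: cvgD; [apply: cvgMr; exact: cvg_fst|exact: cvg_cst].
exact: cvg_snd.
Qed.

Lemma homotopic_sym f g : homotopic K f g -> homotopic K g f.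
Proof.
move=> [F [t0 [t1 [cF KF F0 F1]]]].
exists (F \o (fun z : R * T => (-1 * z.1 + 0, z.2))), (- t1), (- t0).
split=> [|z|t x tt|t x tt] /=; last 2 first.
- by apply: F1; lra.
- by apply: F0; lra.
- by apply: lower_cont_comp cF; exact: continuous_fst_affine.
- exact: (KF (_, _)).
Qed.

Lemma closed_before (t1 : R) : closed [set z : R * T | z.1 <= t1].
Proof.
apply: (@closed_comp _ _ fst [set t | t <= t1]); last exact: closed_le.
by move=> z _; exact: cvg_fst.
Qed.

Lemma homotopic_trans f g h :
  homotopic K f g -> homotopic K g h -> homotopic K f h.
Proof.
move=> [F [t0 [t1 [cF KF F0 F1]]]] [G [u0 [u1 [cG KG G0 G1]]]].
pose s (z : R * T) : R * T := (1 * z.1 + (u0 - t1), z.2).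
have cGs : lower_cont le (G \o s).
  by apply: lower_cont_comp cG; exact: continuous_fst_affine.
exists (fun z => if `[< z.1 <= t1 >] then F z else G (s z)).
exists (Num.min t0 t1), (Num.max (t1 + 1) (t1 + u1 - u0)); split.
- apply: (@lower_cont_if _ _ le [set z | z.1 <= t1] (G \o s) F
    (@closed_before t1)) => [z _|[t x] /= tt1]; first exact: cGs.
  have [tlt|tge] := ltP t t1.
    have nt : \forall y \near (t, x), (y : R * T).1 < t1.
      apply: (@cvg_fst _ _ (nbhs t) (nbhs x) _ [set t | t < t1]).
      exact: lt_nbhsl.
    by apply: filterS2 nt (cF (t, x)) => y yt1 Fy; split=> // /negP; lra.
  have -> : t = t1 by apply/eqP; rewrite eq_le tt1 tge.
  apply: filterS2 (cF (t1, x)) (cGs (t1, x)) => y Fy Gy; split=> // _.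
  by rewrite F1// -(G0 (1 * t1 + (u0 - t1)) x)//; lra.
- by move=> z; case: asboolP => // _; exact: (KG (_, _)).
- move=> t x; rewrite le_min => /andP[tt0 tt1] /=.
  by rewrite asboolT// F0.
- move=> t x; rewrite ge_max => /andP[tt0 tt1] /=.
  by rewrite asboolF; [rewrite /s/= G1//; lra|move=> /=; lra].
Qed.

(** Comparable maps are homotopic by a jump at time 0, since the larger one is
    used on a closed half of the cylinder. *)
Lemma homotopic_le f g : lower_cont le f -> lower_cont le g ->
  (forall x, K x (f x)) -> (forall x, K x (g x)) -> (forall x, le (f x) (g x)) ->
  homotopic K f g.
Proof.
move=> cf cg Kf Kg fg.
have c2 (k : T -> V) : lower_cont le k ->
    lower_cont le (fun z : R * T => k z.2).
  by move=> ck; apply: (lower_cont_comp _ ck) => z; exact: cvg_snd.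
exists (fun z => if `[< 0 <= z.1 >] then g z.2 else f z.2), (-1), 0; split.
- apply: (@lower_cont_if _ _ le [set z : R * T | 0 <= z.1]
    (fun z => f z.2) (fun z => g z.2)).
  + apply: (@closed_comp _ _ fst [set t : R | 0 <= t]); last exact: closed_ge.
    by move=> z _; exact: cvg_fst.
  + by move=> z _; exact: (c2 _ cf).
  + move=> z _; apply: filterS2 (c2 _ cg z) (c2 _ cf z) => y gy fy.
    by split=> // _; exact: le_trans fy (fg _).
- by move=> z; case: asboolP.
- by move=> t x tN; rewrite asboolF //=; lra.
- by move=> t x tN; rewrite asboolT.
Qed.

Lemma homotopic_refl f : lower_cont le f -> (forall x, K x (f x)) ->
  homotopic K f f.
Proof. by move=> *; exact: homotopic_le. Qed.

End Homotopies.

(** * Pushing maps off closed sets *)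

Section Pushing.
Context (R : realType) (V : Type) (le : V -> V -> Prop).
Hypothesis le_refl : forall v, le v v.
Hypothesis le_trans : forall u v w, le u v -> le v w -> le u w.

(** The last clause is continuity in time and space at once, uniformly in the
    points as for a contraction of a finite space. *)
Definition contractible_in (A : set V) :=
  exists (p : V) (H : R -> V -> V),
    [/\ A p, forall t v, A v -> A (H t v), forall t v, t <= 0 -> H t v = v,
        forall t v, A v -> 1 <= t -> H t v = p &
        forall t, \forall s \near t, forall u v, A u -> A v -> le u v ->
          le (H s u) (H t v)].

(** The contraction of [A] is run at a speed given by a Urysohn function [phi]
    which is 2 on [C] and -1 off [O]. Near [C] it is completed, so the result
    is constant there and does not depend on the values of [f] on [C]. *)
Lemma push_off (Y : topologicalType) (A : set V) (C O : set Y) (f : Y -> V) :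
  normal_space Y -> contractible_in A -> closed C -> open O -> C `<=` O ->
  (forall x, O x -> ~ C x -> A (f x) /\ lower_cont_at le f x) ->
  exists (g : Y -> V) (N : set Y),
    [/\ closed N, N `<=` O, forall x, ~ N x -> g x = f x &
        forall x, O x -> A (g x) /\ lower_cont_at le g x].
Proof.
move=> nY [p [H [Ap AH H0 H1 cH]]] clC oO CO fO.
have : uniform_separator (~` O) C.
  move/(@normal_separatorP R): nY; apply => //; first exact: open_closedC.
  by apply/seteqP; split=> // x [nOx /CO].
move/(@uniform_separatorP _ R) => [h [ch h01 h0 h1]].
pose phi x := 3 * h x - 1.
have cphi : continuous phi.
  by move=> x; apply: cvgB; [apply: cvgMr; exact: ch|exact: cvg_cst].
have phiC x : C x -> phi x = 2.
  by move=> Cx; rewrite /phi; have /= -> := h1 (h x) (ex_intro2 _ _ x Cx erefl);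
     lra.
have phiO x : ~ O x -> phi x = -1.
  by move=> Cx; rewrite /phi; have /= -> := h0 (h x) (ex_intro2 _ _ x Cx erefl);
     lra.
pose g x := if `[< C x >] then p else H (phi x) (f x).
exists g, [set x | 0 <= phi x]; split.
- by apply: (@closed_comp _ _ phi [set t : R | 0 <= t]) => //; exact: closed_ge.
- by move=> x /= px; apply: contrapT => /phiO px1; move: px; rewrite px1; lra.
- move=> x /= /negP; rewrite -ltNge => px; rewrite /g asboolF; last first.
    by move=> /phiC; lra.
  by rewrite H0 // ltW.
move=> x Ox; have [Cx|nCx] := pselect (C x).
  split; first by rewrite /g asboolT.
  have n1 : \forall y \near x, 1 < phi y.
    by apply: (cphi x [set t | 1 < t]); apply: lt_nbhsr; rewrite phiC//; lra.
  have nO : \forall y \near x, O y by exact: open_nbhs_nbhs.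
  apply: filterS2 n1 nO => y py Oy; rewrite /g [in X in le _ X]asboolT//.
  case: asboolP => // nCy; rewrite H1 //; first by have [] := fO y Oy nCy.
  exact: ltW.
have [Af cf] := fO x Ox nCx.
split; first by rewrite /g asboolF//; exact: AH.
apply: (@lower_cont_near _ _ _ (fun x => H (phi x) (f x))).
  have nC : nbhs x (~` C) by exact/open_nbhs_nbhs/(conj (closed_openC clC)).
  by apply: filterS nC => y nCy; rewrite /g asboolF.
have nO : nbhs x (O `&` ~` C).
  by apply: open_nbhs_nbhs; split => //; apply: openI => //; exact: closed_openC.
apply: filterS3 nO cf (cphi x _ (cH (phi x))) => y [Oy Cy] fyx Hy.
apply: Hy => //; by have [] := fO y Oy Cy.
Qed.

(** For [S] a sphere of dimension [n] this says that the [n]-th homotopy group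
    is trivial at all base points. *)
Definition sphere_null (S : topologicalType) (K : set V) :=
  forall f : S -> V, lower_cont le f -> (forall s, K (f s)) ->
    exists2 q, K q & homotopic R le (fun=> K) f (fun=> q).

(** The part of [K] outside of [A] is covered by the cone [U_b], and [f] is
    pushed off it into [A]. The new map and [f] differ on a closed set that
    both send below [b], so they are homotopic through [b]. *)
Lemma push_down (S : topologicalType) (A K : set V) (b : V) (f : S -> V) :
  normal_space S -> A `<=` K -> K b ->
  (forall u v, K u -> A v -> le u v -> A u) ->
  (forall v, K v -> A v \/ le v b) ->
  contractible_in (A `&` [set v | le v b]) ->
  lower_cont le f -> (forall s, K (f s)) ->
  exists g, [/\ lower_cont le g, forall s, A (g s) & homotopic R le (fun=> K) f g].
Proof.
move=> nS AK Kb Adown AUb cT cf Kf.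
have opA : open [set s | A (f s)].
  rewrite openE => s /= As; apply: filterS (cf s) => y; exact: Adown.
have opO : open [set s | le (f s) b].
  rewrite openE => s /= bs; apply: filterS (cf s) => y fy; exact: le_trans bs.
have [| |g [N [clN NO gf gO]]] :=
    @push_off _ _ _ _ f nS cT (open_closedC opA) opO.
- by move=> s /= nA; have [] := AUb _ (Kf s).
- move=> s /= bs /contrapT As; split; [by split|exact: cf].
have gE s : g s = f s \/ le (g s) b /\ le (f s) b.
  have [/NO bs|/gf] := pselect (N s); last by left.
  by right; split => //; have [[]] := gO s bs.
have nN s : ~ N s -> \forall y \near s, ~ N y.
  by move=> nNs; exact: open_nbhs_nbhs (conj (closed_openC clN) nNs).
have cg : lower_cont le g.
  move=> s; have [bs|nb] := pselect (le (f s) b); first by have [] := gO s bs.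
  have nNs : ~ N s by move/NO.
  apply: (@lower_cont_near _ _ _ f); last exact: cf.
  by apply: filterS (nN s nNs) => y /gf.
have Ag s : A (g s).
  have [bs|nb] := pselect (le (f s) b); first by have [[]] := gO s bs.
  by rewrite gf; [have [] := AUb _ (Kf s)|move/NO].
exists g; split => //.
(* It suffices to raise [f] and [g] to [b] on [N], where both lie below [b]. *)
pose m s := if `[< N s >] then b else f s.
have cm : lower_cont le m.
  apply: lower_cont_if => // s /NO bs.
  have nO : \forall y \near s, le (f y) b.
    by apply: filterS (cf s) => y fy; exact: le_trans bs.
  by apply: filterS nO => y.
have Km s : K (m s) by rewrite /m; case: asboolP.
apply: (@homotopic_trans _ _ _ _ _ _ m).
  by apply: homotopic_le => // s; rewrite /m; case: asboolP => // /NO.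
apply: homotopic_sym; apply: homotopic_le => // s; first exact/AK/Ag.
rewrite /m; case: asboolP => [/NO bs|/gf ->//].
by have [[]] := gO s bs.
Qed.

Lemma sphere_null_cone (S : topologicalType) (A K : set V) (b : V) :
  normal_space S -> A `<=` K -> K b ->
  (forall u v, K u -> A v -> le u v -> A u) ->
  (forall v, K v -> A v \/ le v b) ->
  contractible_in (A `&` [set v | le v b]) ->
  sphere_null S A -> sphere_null S K.
Proof.
move=> nS AK Kb Adown AUb cT nA f cf Kf.
have [g [cg Ag fg]] := push_down nS AK Kb Adown AUb cT cf Kf.
have [q Aq [F [t0 [t1 [cF AF F0 F1]]]]] := nA g cg Ag.
exists q; [exact: AK|]; apply: homotopic_trans fg _.
by exists F, t0, t1; split => // z; exact: AK.
Qed.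

End Pushing.

Lemma homotopic_comp (R : realType) V V' (le : V -> V -> Prop)
    (le' : V' -> V' -> Prop) (T : topologicalType) (K : set V) (K' : set V')
    (h : V -> V') (f g : T -> V) :
  (forall v, K v -> K' (h v)) ->
  (forall u v, K u -> K v -> le u v -> le' (h u) (h v)) ->
  homotopic R le (fun=> K) f g -> homotopic R le' (fun=> K') (h \o f) (h \o g).
Proof.
move=> KK' hle [F [t0 [t1 [cF KF F0 F1]]]].
exists (h \o F), t0, t1; split => [z|z|t x tt|t x tt] /=.
- by apply: filterS (cF z) => y; exact: hle.
- exact: KK'.
- by rewrite F0.
- by rewrite F1.
Qed.

(** A null-homotopy of [k \o f] is transported by [h], which gives one of [f]
    because [h \o k] is the identity on [K']. *)
Lemma sphere_null_iso (R : realType) V V' (le : V -> V -> Prop)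
    (le' : V' -> V' -> Prop) (S : topologicalType) (K : set V) (K' : set V')
    (h : V -> V') (k : V' -> V) :
  (forall v, K v -> K' (h v)) -> (forall v, K' v -> K (k v)) ->
  (forall v, K' v -> h (k v) = v) ->
  (forall u v, K u -> K v -> le u v -> le' (h u) (h v)) ->
  (forall u v, K' u -> K' v -> le' u v -> le (k u) (k v)) ->
  sphere_null R le S K -> sphere_null R le' S K'.
Proof.
move=> hK kK hk hle kle nK f cf Kf.
have [|s|q Kq fq] := nK (k \o f).
- by move=> s; apply: filterS (cf s) => y; exact: kle.
- exact: kK.
exists (h q); first exact: hK.
have -> : f = h \o (k \o f) by apply/funext => s /=; rewrite hk.
exact: (homotopic_comp hK hle fq).
Qed.

(** * Contractible posets and beat points *)

(** Connectedness of the line, in the form used for discrete invariants of a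
    moving point. *)
Lemma locally_constant (R : realType) (A : Type) (g : R -> A) :
  (forall t, \forall s \near t, g s = g t) -> forall s t, g s = g t.
Proof.
move=> lg s t.
have /connected_intervalP cR : is_interval [set: R] by [].
have oE (B : set A) : open [set u | B (g u)].
  by rewrite openE => u /= Bu; apply: filterS (lg u) => v /= ->.
suff : [set u | g u = g t] = setT by move=> /seteqP[_ /(_ s I)].
apply: cR; first by exists t.
- exists [set u | g u = g t]; last by rewrite setTI.
  exact: (oE [set x | x = g t]).
- exists [set u | g u = g t]; last by rewrite setTI.
  have -> : [set u | g u = g t] = ~` [set u | g u <> g t].
    by apply/seteqP; split => u /= h; [by move=> nh; exact: nh|exact: contrapT].
  exact: (open_closedC (oE [set x | x <> g t])).
Qed.

Section BeatPoints.
Context (R : realType) (d : Order.disp_t) (X : finPOrderType d).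
Local Open Scope order_scope.
Local Open Scope classical_set_scope.
Implicit Types (W : set X) (x y z : X).

Local Notation leX := (fun x y : X => x <= y : Prop).

(** Beat points in the sense of Stong. Removing a beat point [x] does not
    change the homotopy type: [x] is moved to the point [y] next to it. *)
Definition up_beat W x y := x < y /\ forall z, W z -> x < z -> y <= z.
Definition down_beat W x y := y < x /\ forall z, W z -> z < x -> z <= y.

Let retr x y z := if z == x then y else z.

Lemma beat_retr_le W x y u v : up_beat W x y \/ down_beat W x y ->
  W u -> W v -> u <= v -> retr x y u <= retr x y v.
Proof.
rewrite /retr => -[[xy yW]|[yx yW]] Wu Wv uv.
  have [ux|ux] := eqVneq u x; have [vx|vx] := eqVneq v x; rewrite ?lexx//.
    by apply: yW => //; rewrite lt_neqAle eq_sym vx -ux.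
  by rewrite (le_trans uv)// vx ltW.
have [ux|ux] := eqVneq u x; have [vx|vx] := eqVneq v x; rewrite ?lexx//.
  by rewrite (le_trans _ uv)// ux ltW.
by apply: yW => //; rewrite lt_neqAle ux -vx.
Qed.

Lemma beat_neq W x y : up_beat W x y \/ down_beat W x y -> y != x.
Proof. by move=> [[/lt_eqF/negbT]|[/lt_eqF/negbT]] //; rewrite eq_sym. Qed.

(** The first half of the time interval is spent on moving [x] to [y], the
    second half on the given contraction. The position at time 1/2 itself has
    to be the larger one of [x] and [y]. *)
Lemma contractible_add_beat W x y : W y -> up_beat W x y \/ down_beat W x y ->
  contractible_in R leX (W `\ x) -> contractible_in R leX W.
Proof.
move=> Wy bxy [p [H [[Wp px] WH H0 H1 cH]]].
have yx := beat_neq bxy.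
have Wr v : W v -> (W `\ x) (retr x y v).
  move=> Wv; rewrite /retr; have [vx|vx] := eqVneq v x.
    by split=> //; exact/eqP.
  by split=> //; exact/eqP.
have rle u v : W u -> W v -> u <= v -> retr x y u <= retr x y v.
  exact: beat_retr_le bxy.
have clt (t : R) : (\forall s \near t, forall u v, W u -> W v -> (u <= v)%O ->
    (H (2 * s - 1) (retr x y u) <= H (2 * t - 1)%R (retr x y v))%O)%R.
  have c2 : ((fun s : R => 2 * s - 1) @ t --> 2 * t - 1)%R.
    by apply: cvgB; [apply: cvgMr; exact: cvg_id|exact: cvg_cst].
  have : (\forall s \near t, forall u v, (W `\ x) u -> (W `\ x) v ->
    (u <= v)%O -> (H (2 * s - 1) u <= H (2 * t - 1)%R v)%O)%R.
    exact: (c2 _ (cH (2 * t - 1)%R)).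
  apply: filterS => s Hs u v Wu Wv uv.
  by apply: Hs; [exact: Wr|exact: Wr|exact: rle].
case: bxy => [[xy yW]|[xy yW]].
- exists p, (fun t v => if (t < 2^-1)%R then v else
    H (2 * t - 1)%R (retr x y v)).
  split=> [//|t v Wv|t v t0|t v Wv t1|t].
  + by case: ifP => // _; have [] := WH (2 * t - 1)%R _ (Wr v Wv).
  + by rewrite ifT//; lra.
  + by rewrite ifF; [apply: H1 (Wr v Wv) _; lra|apply/negbTE; rewrite -leNgt; lra].
  + have [t2|t2] := ltP t (2^-1)%R.
      by apply: filterS (lt_nbhsl t2) => s -> u v _ _.
    have [{t2}->|tn] := eqVneq t (2^-1)%R.
      apply: filterS (clt (2^-1)%R) => s Hs u v Wu Wv uv.
      case: ifP => _; last exact: Hs.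
      rewrite H0; last lra.
      apply: le_trans uv _; rewrite /retr; case: eqVneq => [->|//].
      exact: ltW.
    have {tn}t2 : (2^-1 < t)%R by rewrite lt_neqAle eq_sym tn.
    apply: filterS2 (lt_nbhsr t2) (clt t) => s ts Hs u v Wu Wv uv.
    by rewrite ifF; [exact: Hs|apply/negbTE; rewrite -leNgt ltW].
- exists p, (fun t v => if (t <= 2^-1)%R then v else
    H (2 * t - 1)%R (retr x y v)).
  split=> [//|t v Wv|t v t0|t v Wv t1|t].
  + by case: ifP => // _; have [] := WH (2 * t - 1)%R _ (Wr v Wv).
  + by rewrite ifT//; lra.
  + by rewrite ifF; [apply: H1 (Wr v Wv) _; lra|apply/negbTE; rewrite -ltNge; lra].
  + have [t2|t2] := leP t (2^-1)%R.
      have [{t2}->|tn] := eqVneq t (2^-1)%R; last first.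
        have {tn}t2 : (t < 2^-1)%R by rewrite lt_neqAle tn.
        by apply: filterS (lt_nbhsl t2) => s /ltW -> u v _ _.
      apply: filterS (clt (2^-1)%R) => s Hs u v Wu Wv uv.
      case: ifP => // _; apply: le_trans (Hs u v Wu Wv uv) _.
      rewrite H0; last lra.
      rewrite /retr; case: eqVneq => [->|//]; exact: ltW.
    apply: filterS2 (lt_nbhsr t2) (clt t) => s ts Hs u v Wu Wv uv.
    by rewrite ifF; [exact: Hs|apply/negbTE; rewrite -ltNge].
Qed.

Lemma contractible_remove_beat W x y : W y ->
  up_beat W x y \/ down_beat W x y ->
  contractible_in R leX W -> contractible_in R leX (W `\ x).
Proof.
move=> Wy bxy [p [H [Wp WH H0 H1 cH]]].
have yx := beat_neq bxy.
have Wr v : W v -> (W `\ x) (retr x y v).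
  move=> Wv; rewrite /retr; have [vx|vx] := eqVneq v x.
    by split=> //; exact/eqP.
  by split=> //; exact/eqP.
exists (retr x y p), (fun t v => if v == x then v else retr x y (H t v)).
split=> [|t v [Wv /eqP/negbTE vx]|t v t0|t v [Wv /eqP/negbTE vx] t1|t].
- exact: Wr.
- by rewrite vx; apply: Wr; exact: WH.
- by case: (boolP (v == x)) => // /negbTE vx; rewrite H0// /retr vx.
- by rewrite vx H1.
- apply: filterS (cH t) => s Hs u v [Wu /eqP/negbTE ux] [Wv /eqP/negbTE vx] uv.
  rewrite ux vx; apply: (beat_retr_le bxy); [exact: WH|exact: WH|exact: Hs].
Qed.

(** A point [x] that is minimal among those moved by [g] would be a down beat
    point with lower neighbour [g x]. *)
Lemma no_down_beat_id W (g : X -> X) : (forall x, W x -> W (g x)) ->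
  (forall x y, W x -> W y -> x <= y -> g x <= g y) ->
  (forall x, W x -> g x <= x) -> (forall x y, W x -> W y -> ~ down_beat W x y) ->
  forall x, W x -> g x = x.
Proof.
move=> Wg gle gx nb x; have [n] := ubnP #|[pred z | z <= x]|.
elim: n x => // n IH x nx Wx; apply: contrapT => gxx.
apply: (nb x (g x) Wx (Wg _ Wx)); split.
  by rewrite lt_neqAle gx// andbT; exact/eqP.
move=> z Wz zx; rewrite -(IH z)//; first by apply: gle => //; exact: ltW.
move: nx; rewrite ltnS; apply: leq_trans; apply: proper_card; apply/properP; split.
  by apply/fintype.subsetP => w; rewrite !inE => wz; rewrite (le_trans wz)// ltW.
exists x; rewrite inE; first exact: lexx.
 by apply/negP => /= h; have := lt_le_trans zx h; rewrite ltxx.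
Qed.

Lemma no_up_beat_id W (g : X -> X) : (forall x, W x -> W (g x)) ->
  (forall x y, W x -> W y -> x <= y -> g x <= g y) ->
  (forall x, W x -> x <= g x) -> (forall x y, W x -> W y -> ~ up_beat W x y) ->
  forall x, W x -> g x = x.
Proof.
move=> Wg gle gx nb x; have [n] := ubnP #|[pred z | x <= z]|.
elim: n x => // n IH x nx Wx; apply: contrapT => gxx.
apply: (nb x (g x) Wx (Wg _ Wx)); split.
  by rewrite lt_neqAle gx// andbT; apply/eqP => h; exact: gxx.
move=> z Wz zx; rewrite -(IH z)//; first by apply: gle => //; exact: ltW.
move: nx; rewrite ltnS; apply: leq_trans; apply: proper_card; apply/properP; split.
  by apply/fintype.subsetP => w; rewrite !inE => wz; rewrite (le_trans _ wz)// ltW.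
exists x; rewrite inE; first exact: lexx.
 by apply/negP => /= h; have := lt_le_trans zx h; rewrite ltxx.
Qed.

(** Without beat points the identity is isolated among the order-preserving
    maps, so a homotopy starting at the identity never leaves it. *)
Lemma contractible_has_beat W : contractible_in R leX W ->
  (exists p, W = [set p]) \/
  exists x y, [/\ W x, W y & up_beat W x y \/ down_beat W x y].
Proof.
move=> [p [H [Wp WH H0 H1 cH]]].
have [|nb] := pselect (exists x y,
  [/\ W x, W y & up_beat W x y \/ down_beat W x y]); [by right|left; exists p].
have mono t x y : W x -> W y -> x <= y -> H t x <= H t y.
  exact: (nbhs_singleton (cH t)).
have lc : forall t : R, \forall s \near t,
    (forall x, W x -> H s x = x) = (forall x, W x -> H t x = x).
  move=> t; apply: filterS (cH t) => s Hs.
  apply/propext; split => Hid; [apply: no_up_beat_id|apply: no_down_beat_id].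
  - by move=> x; exact: WH.
  - exact: mono.
  - by move=> x Wx; rewrite -{1}(Hid x Wx); exact: Hs.
  - by move=> x y Wx Wy b; apply: nb; exists x, y; split=> //; left.
  - by move=> x; exact: WH.
  - exact: mono.
  - by move=> x Wx; rewrite -[leRHS](Hid x Wx); exact: Hs.
  - by move=> x y Wx Wy b; apply: nb; exists x, y; split=> //; right.
have idH : forall x, W x -> H 1%R x = x.
  by rewrite (locally_constant lc 1%R 0%R) => x Wx; rewrite H0.
apply/seteqP; split=> [x Wx|x ->//].
by rewrite /= -(idH x Wx) H1.
Qed.

Lemma contractible_max W m : W m -> (forall x, W x -> x <= m) ->
  contractible_in R leX W.
Proof.
move=> Wm Wle; exists m, (fun t v => if (t < 1)%R then v else m).
split=> [//|t v Wv|t v t0|t v Wv t1|t].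
- by case: ifP.
- by rewrite ifT//; lra.
- by rewrite ltNge t1.
- have [t1|t1] := ltP t 1%R.
    by apply: filterS (lt_nbhsl t1) => s -> u v _ _.
  by near=> s => u v Wu Wv uv; case: ifP => // _; exact: Wle.
Unshelve. all: by end_near. Qed.

(** Induction on the size of [W], removing a beat point [x] of [W]. If [x] lies
    below both [a] and [b], so do its neighbours and [x] is a beat point of the
    intersection. If [x] is [a] (the case of [b] is symmetric), then [a] has a
    unique lower neighbour [y], which either takes over the role of [a] or is
    the maximum of the intersection. In the other cases the intersection is not
    affected. *)
Lemma contractible_cap W a b :
  W a -> W b -> ~~ (a <= b) -> ~~ (b <= a) ->
  (forall x, W x -> x <= a \/ x <= b) ->
  contractible_in R leX W ->
  contractible_in R leX (W `&` [set x | x <= a /\ x <= b]).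
Proof.
have [n] := ubnP #|[pred x | `[< W x >]]|.
elim: n W a b => // n IH W a b nW Wa Wb nab nba Wab cW.
have [[p Wp]|[x [y [Wx Wy bxy]]]] := contractible_has_beat cW.
  by move: Wa Wb nab; rewrite Wp => -> ->; rewrite lexx.
have cWx := contractible_remove_beat Wy bxy cW.
have nWx : (#|[pred z | `[< (W `\ x) z >]]| < n)%N.
  move: nW; rewrite ltnS; apply: leq_trans; apply: proper_card; apply/properP; split.
    by apply/fintype.subsetP => w /asboolP[Ww _]; exact/asboolP.
  by exists x; [exact/asboolP|apply/asboolPn => -[_ /=]].
have sym (A : set X) : A `&` [set x | x <= a /\ x <= b] =
    A `&` [set x | x <= b /\ x <= a].
  by apply/seteqP; split => z [Az [za zb]].
have top c e : W c -> W e -> ~~ (c <= e) -> ~~ (e <= c) ->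
    (forall x, W x -> x <= c \/ x <= e) -> x = c ->
    contractible_in R leX (W `&` [set x | x <= c /\ x <= e]).
  move=> Wc We nce nec Wce xc; subst x.
  case: bxy => [[cy _]|[yc yW]].
    have [yc|ye] := Wce y Wy.
      by have := lt_le_trans cy yc; rewrite ltxx.
    by move: nce; rewrite (le_trans (ltW cy) ye).
  have ltc z : z <= c -> z <= e -> z < c.
    move=> zc ze; rewrite lt_neqAle zc andbT; apply: contra nce => /eqP <-.
    exact: ze.
  have [ye|nye] := boolP (y <= e).
    apply: (@contractible_max _ y); first by split=> //; split=> //; exact: ltW.
    by move=> z [Wz [zc ze]]; apply: yW => //; exact: ltc.
  rewrite (_ : W `&` _ = (W `\ c) `&` [set x | x <= y /\ x <= e]); last first.
    apply/seteqP; split => z.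
      move=> [Wz [zc ze]]; have zlc := ltc z zc ze; split; split => //.
        by move=> zz; move: zlc; rewrite zz ltxx.
      exact: yW.
    by move=> [[Wz _] [zy ze]]; split=> //; split=> //; exact: (le_trans zy (ltW yc)).
  apply: IH => //.
  - by split=> // yc'; move: yc; rewrite yc' ltxx.
  - by split=> // ec; move: nec; rewrite ec lexx.
  - by apply: contra nec => ey; exact: le_trans ey (ltW yc).
  - move=> z [Wz zc]; have [zlc|] := Wce z Wz; last by right.
    by left; apply: yW => //; rewrite lt_neqAle zlc andbT; exact/eqP.
have [xa|xna] := eqVneq x a; first exact: top.
have [xb|xnb] := eqVneq x b.
  by rewrite sym; apply: top => // z /Wab[]; [right|left].
have cT : contractible_in R leX ((W `\ x) `&` [set x | x <= a /\ x <= b]).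
  apply: IH => //.
  - by split=> // ax; move: xna; rewrite ax eqxx.
  - by split=> // bx; move: xnb; rewrite bx eqxx.
  - by move=> z [] /Wab.
have [[xa xb]|nT] := pselect (x <= a /\ x <= b); last first.
  rewrite (_ : W `&` _ = (W `\ x) `&` [set x | x <= a /\ x <= b])//.
  apply/seteqP; split => z; last by move=> [[]].
  by move=> [Wz zab]; split=> //; split=> // zx; apply: nT; rewrite -zx.
have lxa : x < a by rewrite lt_neqAle xna.
have lxb : x < b by rewrite lt_neqAle xnb.
apply: (@contractible_add_beat _ x y); first split => //=.
- case: bxy => [[_ yW]|[yx _]].
    by split; exact: yW.
  by split; exact: (le_trans (ltW yx)).
- case: bxy => -[xy yW]; [left|right]; split=> // z [Wz _]; exact: yW.
- by rewrite -setIDA -setIDAC.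
Qed.

End BeatPoints.

(** * Finite spaces as posets *)

Lemma within_continuous_comp_in (S T U : topologicalType) (A : set T)
    (g : S -> T) (f : T -> U) :
  continuous g -> (forall s, A (g s)) -> {within A, continuous f} ->
  continuous (f \o g).
Proof.
move=> cg Ag /subspace_continuousP cf s B /= /(cf _ (Ag s)) fB.
have gB : \forall y \near s, A (g y) -> B (f (g y)) by exact: (cg s _ fB).
by apply: filterS gB => y; exact.
Qed.

Definition clamp01 (R : realType) (t : R) : R := Num.max 0 (Num.min 1 t).

Lemma clamp01_ge0 (R : realType) (t : R) : 0 <= clamp01 t.
Proof. by rewrite /clamp01 le_max lexx. Qed.

Lemma clamp01_le1 (R : realType) (t : R) : clamp01 t <= 1.
Proof. by rewrite /clamp01 ge_max ler01 ge_min lexx. Qed.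

Lemma clamp01_le0 (R : realType) (t : R) : t <= 0 -> clamp01 t = 0.
Proof.
by move=> t0; rewrite /clamp01; apply/max_idPl; rewrite ge_min t0 orbT.
Qed.

Lemma clamp01_ge1 (R : realType) (t : R) : 1 <= t -> clamp01 t = 1.
Proof. by move=> t1; rewrite /clamp01 min_l// max_r. Qed.

Lemma clamp01_id (R : realType) (t : R) : 0 <= t <= 1 -> clamp01 t = t.
Proof. by move=> /andP[t0 t1]; rewrite /clamp01 min_r// max_r. Qed.

Lemma clamp01_continuous (R : realType) : continuous (@clamp01 R).
Proof.
move=> t; apply: continuous_max; first exact: cvg_cst.
by apply: continuous_min; [exact: cvg_cst|exact: cvg_id].
Qed.

Section FinSpaces.
Context (R : realType) (d : Order.disp_t) (X : finPOrderType d).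
Local Notation leX := (fun x y : X => (x <= y)%O : Prop).
Implicit Types (W : set (fin_space X)).

Lemma open_minimal_open (x : X) : open (minimal_open x).
Proof. by move=> u v uv vx; exact: (le_trans uv vx). Qed.

Lemma continuous_lower_cont (S : topologicalType) W (f : S -> set_type W) :
  continuous f -> lower_cont leX (fun s => set_val (f s) : X).
Proof.
move=> cf s.
have oU : open (minimal_open (set_val (f s) : X)) by exact: open_minimal_open.
have /initial_continuous nU : nbhs (set_val (f s)) (minimal_open (set_val (f s) : X)).
  by apply: open_nbhs_nbhs; split => //=; exact: lexx.
exact: (cf s _ nU).
Qed.

Lemma lower_cont_continuous (S : topologicalType) W (f : S -> set_type W) :
  lower_cont leX (fun s => set_val (f s) : X) -> continuous f.
Proof.
move=> cf; apply: continuous_comp_initial => s B.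
move=> /= [U [oU Us] UB]; apply: filterS (cf s) => y fy; apply: UB.
exact: oU fy Us.
Qed.

(** As [X] is finite, the neighbourhoods of time [t] obtained for the single
    points have a common intersection. *)
Lemma contractible_contractible_in W :
  contractible R (set_type W) -> contractible_in R leX W.
Proof.
move=> [p [H [cH H0 H1]]].
pose sub v := if pselect (W v) is left Wv then exist _ v (mem_set Wv) else p.
have subK v : W v -> set_val (sub v) = v :> X.
  by rewrite /sub; case: pselect.
have cH' : continuous (H \o (fun z : R * set_type W => (clamp01 z.1, z.2))).
  apply: within_continuous_comp_in cH.
    move=> z; apply: (@cvg_pair _ _ _ _ (nbhs (clamp01 z.1)) (nbhs z.2)).
      apply: (@continuous_comp _ _ _ fst (@clamp01 R)); first exact: cvg_fst.
      exact: clamp01_continuous.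
    exact: cvg_snd.
  by move=> z; split => //=; rewrite in_itv /= clamp01_ge0 clamp01_le1.
have lH := continuous_lower_cont cH'.
exists (set_val p), (fun t v => if `[< W v /\ 0 <= t >] then
  set_val (H (clamp01 t, sub v)) else v).
split.
- exact: set_valP.
- by move=> t v Wv; case: asboolP => // _; exact: set_valP.
- move=> t v t0; case: asboolP => // -[Wv t0'].
  by rewrite clamp01_le0// H0 subK.
- move=> t v Wv t1; rewrite asboolT; first by rewrite clamp01_ge1// H1.
  by split => //; lra.
move=> t.
have HE s v : W v -> (if `[< W v /\ 0 <= s >] then
    set_val (H (clamp01 s, sub v)) else v) = set_val (H (clamp01 s, sub v)).
  move=> Wv; case: asboolP => // /not_andP[//|/negP]; rewrite -ltNge => s0.
  by rewrite clamp01_le0 ?H0 ?subK// ltW.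
pose Q (v : X) (s : R) := forall u : X, W u -> W v -> (u <= v)%O ->
  (set_val (H (clamp01 s, sub u)) <= set_val (H (clamp01 t, sub v)) :> X)%O.
suff /(@filter_forall _ X Q (nbhs t) _) : forall v, \forall s \near t, Q v s.
  by apply: filterS => s Hs u v Wu Wv uv; rewrite !HE//; exact: Hs.
move=> v.
have [[A B] [/= At Bv] AB] := lH (t, sub v).
have {}At : \forall s \near t, A s by [].
apply: filterS At => s As u Wu Wv uv.
apply: (AB (s, sub u)); split=> //=.
have [B' [[B'' oB'' B''B'] B'v] B'B] := Bv.
apply: B'B; move: B'v; rewrite -B''B' /= => B'v.
by rewrite subK//; apply: oB'' uv _; rewrite -(subK v Wv).
Qed.

End FinSpaces.

(** * Reductions and the complement of a maximal point *)

Section OrderEmbedding.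
Context (R : realType) (d : Order.disp_t) (X : finPOrderType d).
Context (V : Type) (le : V -> V -> Prop) (i : X -> V).
Hypothesis i_le : forall x y, le (i x) (i y) <-> (x <= y)%O.

Lemma embedding_inj : injective i.
Proof.
move=> x y ixy; apply/le_anti/andP.
by split; apply/i_le; rewrite ixy; apply/i_le; exact: lexx.
Qed.

Lemma contractible_in_image (W : set X) :
  contractible_in R (fun x y : X => (x <= y)%O : Prop) W ->
  contractible_in R le (i @` W).
Proof.
move=> [p [H [Wp WH H0 H1 cH]]].
pose k v := if pselect (exists x, i x = v) is left h then projT1 (cid h) else p.
have ik x : k (i x) = x.
  rewrite /k; case: pselect => [h|[]]; last by exists x.
  by apply: embedding_inj; case: (cid h).
exists (i p), (fun t v => if `[< (i @` W) v >] then i (H t (k v)) else v).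
split=> [|t v Wv|t v t0|t _ [v Wv <-] t1|t].
- by exists p.
- rewrite asboolT//; case: Wv => v' Wv' <-; rewrite ik.
  by exists (H t v') => //; exact: WH.
- by case: asboolP => // -[v' Wv' <-]; rewrite ik H0.
- by rewrite asboolT ?ik ?H1//; exists v.
- apply: filterS (cH t) => s Hs _ _ [u Wu <-] [v Wv <-] /i_le uv.
  rewrite !asboolT; [|by exists v|by exists u].
  by rewrite !ik; apply/i_le; exact: Hs.
Qed.

End OrderEmbedding.

(** The point [None] is new. For a transitive relation [D] has to be a
    down-set. *)
Definition adjoin_le V (le : V -> V -> Prop) (D : set V) (u v : option V) :=
  match u, v with
  | Some u, Some v => le u v
  | Some u, None => D u
  | None, Some _ => False
  | None, None => True
  end.

Lemma adjoin_le_refl V (le : V -> V -> Prop) (D : set V) :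
  (forall v, le v v) -> forall v, adjoin_le le D v v.
Proof. by move=> le_refl [v|]. Qed.

Lemma adjoin_le_trans V (le : V -> V -> Prop) (D : set V) :
  (forall u v w, le u v -> le v w -> le u w) ->
  (forall u v, le u v -> D v -> D u) ->
  forall u v w, adjoin_le le D u v -> adjoin_le le D v w -> adjoin_le le D u w.
Proof.
by move=> le_trans leD [u|] [v|] [w|] //=; [exact: le_trans|exact: leD].
Qed.

Section Merge.
Context (R : realType) (S : topologicalType) (V : Type) (le : V -> V -> Prop).
Hypothesis normalRS : normal_space (R * S)%type.
Hypothesis le_refl : forall v, le v v.
Hypothesis le_trans : forall u v w, le u v -> le v w -> le u w.

(** Let [c] be the new point [None]. Sending [a] and [b] to [c] raises [f],
    hence gives a homotopic map; by assumption it is homotopic to a constant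
    without meeting [a] and [b]. The resulting homotopy of [f] passes through
    [c]. Since the points below [c] form a contractible set, it can be pushed
    off [c], and the push is confined to a bounded time interval, so that the
    two ends of the homotopy are preserved. *)
Lemma sphere_null_merge (K : set V) (a b : V) :
  K a -> K b -> (forall v, K v -> le a v -> v = a) ->
  (forall v, K v -> le b v -> v = b) ->
  let D := [set v | le v a \/ le v b] in
  contractible_in R le (K `&` D) ->
  sphere_null R (adjoin_le le D) S
    [set v | if v is Some v then [/\ K v, v <> a & v <> b] else True] ->
  sphere_null R le S K.
Proof.
move=> Ka Kb amax bmax D cD.
set K' := [set v | _] => nK' f cf Kf.
set le' := adjoin_le le D in nK' *.
have Ddown u v : le u v -> D v -> D u.
  by move=> uv [va|vb]; [left|right]; exact: le_trans uv _.
have le'_refl : forall v, le' v v by exact: adjoin_le_refl.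
have le'_trans : forall u v w, le' u v -> le' v w -> le' u w.
  exact: adjoin_le_trans.
pose r v := if `[< v = a \/ v = b >] then None else Some v.
have r_le u v : K u -> K v -> le u v -> le' (r u) (r v).
  move=> Ku Kv uv; rewrite /r; case: asboolP => [u_ab|nu].
    have -> : v = u by case: u_ab uv => -> uv; [exact: amax|exact: bmax].
    by rewrite asboolT.
  by case: asboolP => //= -[va|vb]; [left; rewrite -va|right; rewrite -vb].
have le'_r v : le' (Some v) (r v).
  rewrite /r; case: asboolP => /=; last by move=> _; exact: le_refl.
  by move=> [->|->]; [left|right]; exact: le_refl.
pose KN := [set v | if v is Some v then K v else True].
have [|s|q K'q] := nK' (r \o f).
- by move=> s; apply: filterS (cf s) => y; exact: r_le.
- rewrite /r/=; case: asboolP => //= /not_orP[]; by split.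
move=> rfq; have {}rfq : homotopic R le' (fun=> KN) (r \o f) (fun=> q).
  by apply: (@homotopic_comp _ _ _ _ _ _ K' KN id) rfq => // -[v []|].
have KN_f : homotopic R le' (fun=> KN) (Some \o f) (r \o f).
  apply: homotopic_le => //.
  - by move=> s; apply: filterS (cf s) => y; exact: r_le.
  - by move=> s; rewrite /r/=; case: asboolP => /=.
  - by move=> s; exact: le'_r.
have {KN_f}rfq := homotopic_trans KN_f rfq.
have {rfq} [w Kw fw] : exists2 w, K w & homotopic R le' (fun=> KN) (Some \o f)
    (fun=> Some w).
  case: q K'q rfq => [w|] K'q fq.
    by exists w => //; case: K'q.
  (* A homotopy that ends at the new point is continued down to [a]. *)
  exists a => //; apply: homotopic_trans fq _; apply: homotopic_sym.
  apply: homotopic_le => //.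
  - by move=> s; apply: nearW => y.
  - by move=> s; apply: nearW => y.
  - by move=> s; left.
move: fw => [F [t0 [t1 [cF KF F0 F1]]]].
(* The default [a] only serves on the set [C] that [F] is pushed off. *)
pose f0 z := odflt a (F z).
have cf0 z v : F z = Some v -> lower_cont_at le f0 z.
  move=> Fz; apply: filterS (cF z) => y; rewrite /f0 Fz /=.
  by case: (F y).
pose C := [set z | F z = None].
pose O := [set z | le' (F z) None /\ t0 - 1 < z.1 < t1 + 1].
have clC : closed C.
  rewrite (_ : C = ~` [set z | F z <> None]); last first.
    by apply/seteqP; split => z /= h; [by move=> nh; exact: nh|exact: contrapT].
  apply: open_closedC; rewrite openE => z /= Fz.
  apply: filterS (cF z) => y yz Fy; move: yz Fz; rewrite Fy.
  by case: (F z) => // _; exact.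
have opO : open O.
  rewrite openE => z /= [Fz /andP[z0 z1]].
  have n1 : \forall y \near z, t0 - 1 < (y : R * S).1.
    exact: (@cvg_fst _ _ (nbhs z.1) (nbhs z.2) _ _ (lt_nbhsr z0)).
  have n2 : \forall y \near z, (y : R * S).1 < t1 + 1.
    exact: (@cvg_fst _ _ (nbhs z.1) (nbhs z.2) _ _ (lt_nbhsl z1)).
  apply: filterS3 (cF z) n1 n2 => y Fy y0 y1; split; last by rewrite y0 y1.
  exact: le'_trans Fy Fz.
have CO : C `<=` O.
  move=> [t x] Fz; split; first by rewrite Fz.
  rewrite /= !ltNge; apply/andP; split; apply/negP => tt.
    by move: Fz; rewrite /C /= F0//; lra.
  by move: Fz; rewrite /C /= F1//; lra.
have [z [Fz _] nCz|g [N [clN NO gf gO]]] :=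
    @push_off R V le le_refl _ (K `&` D) C O f0 normalRS cD clC opO CO.
  move: nCz (KF z) Fz; rewrite /C /f0 /=; case Fz : (F z) => [v|//] _ Kv Dv.
  by split=> //; exact: cf0 Fz.
exists w => //; exists g, (t0 - 1), (t1 + 1); split.
- move=> z; have [Oz|nO] := pselect (O z); first by have [] := gO z Oz.
  have nNz : nbhs z (~` N).
    by apply: open_nbhs_nbhs; split; [exact: closed_openC|move/NO].
  apply: (@lower_cont_near _ _ _ f0); first exact: filterS gf nNz.
  case Fz : (F z) => [v|]; first exact: cf0 Fz.
  by have := CO z Fz.
- move=> z; have [Oz|nO] := pselect (O z); first by have [[]] := gO z Oz.
  rewrite gf; last by move/NO.
  by have := KF z; rewrite /f0; case Fz : (F z) => //= _; have := CO z Fz.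
- move=> t x tt; rewrite gf; last by move=> /NO[_ /= /andP[]]; lra.
  by rewrite /f0 F0//; lra.
- move=> t x tt; rewrite gf; last by move=> /NO[_ /= /andP[]]; lra.
  by rewrite /f0 F1//; lra.
Qed.

End Merge.

Section LinkDeterminesComplement.
Context (R : realType) (S : topologicalType).
Hypothesis normalS : normal_space S.
Hypothesis normalRS : normal_space (R * S)%type.

(** [X] is placed in a poset [K] by [i], and the points of [K] outside of [X]
    are attached over [L_c] only. If spheres are null in [L_c] together with
    the extra points, then they are null in the complement of [c]. For [K] =
    [X] this compares the complement of [c] with [L_c]; the extra points are
    tops of cones split off by reductions that involve [c]. *)
Definition link_determines_complement d (X : finPOrderType d) :=
  forall (V : Type) (le : V -> V -> Prop) (K : set V) (i : X -> V) (c : X),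
    (forall v, le v v) -> (forall u v w, le u v -> le v w -> le u w) ->
    (forall x, K (i x)) -> (forall x y, le (i x) (i y) <-> (x <= y)%O) ->
    (forall v x, K v -> le v (i x) -> exists y, v = i y) ->
    (forall v x, K v -> (forall y, v <> i y) -> le (i x) v -> (x < c)%O) ->
    maximal_point c ->
    sphere_null R le S [set v | K v /\ forall x, v = i x -> (x < c)%O] ->
    sphere_null R le S (K `\ i c).

(** If [c] is the maximum, its complement is [L_c]. *)
Lemma link_determines_complement_max d (X : finPOrderType d) :
  has_maximum X -> link_determines_complement X.
Proof.
move=> [m mP] V le K i c le_refl le_trans Ki i_le _ _ cmax.
have cm : m = c by exact/cmax/mP.
congr (sphere_null R le S _); apply/seteqP; split => v /= [Kv vP]; split => //.
  by move=> /vP; rewrite ltxx.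
move=> x vx; rewrite lt_neqAle -{2}cm mP andbT; apply/eqP => xc.
by apply: vP; rewrite vx xc.
Qed.

Lemma qc_space_cases d (X : finPOrderType d) (a b : X) (y : qc_space a b) :
  val y = None \/ exists x, [/\ val y = Some x, x <> a & x <> b].
Proof.
case: y => -[x|] xP /=; last by left.
right; exists x; move: xP => /andP[/eqP xa /eqP xb].
by split=> // xx; [apply: xa; rewrite xx|apply: xb; rewrite xx].
Qed.

Lemma qc_space_some d (X : finPOrderType d) (a b x : X) : x <> a -> x <> b ->
  exists y : qc_space a b, val y = Some x.
Proof.
move=> xa xb.
have xP : ((Some x : add_above a b) != Some a) && ((Some x : add_above a b) != Some b).
  by apply/andP; split; apply/eqP => -[].
by exists (exist _ (Some x : add_above a b) xP).
Qed.

Lemma qc_space_none d (X : finPOrderType d) (a b : X) :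
  exists y : qc_space a b, val y = None.
Proof. by exists (exist _ (None : add_above a b) isT). Qed.

Lemma qc_space_le d (X : finPOrderType d) (a b : X) (y z : qc_space a b) :
  (y <= z)%O = add_above_le (val y) (val z).
Proof. by []. Qed.

Lemma qc_space_lt d (X : finPOrderType d) (a b x x' : X) (y z : qc_space a b) :
  val y = Some x -> val z = Some x' -> (y < z)%O = (x < x')%O.
Proof.
move=> yx zx; rewrite !lt_neqAle qc_space_le yx zx /=; congr (~~ _ && _).
by rewrite -val_eqE yx zx.
Qed.

Lemma qc_space_lt_none d (X : finPOrderType d) (a b x : X)
    (y z : qc_space a b) :
  val y = Some x -> val z = None -> (y < z)%O = ((x <= a)%O || (x <= b)%O).
Proof.
move=> yx zN; rewrite lt_neqAle qc_space_le yx zN /=.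
by rewrite -val_eqE yx zN.
Qed.

Section QcStep.
Context (d : Order.disp_t) (X : finPOrderType d) (a b : X).
Hypotheses (amax : maximal_point a) (bmax : maximal_point b) (ab : a <> b).
Hypothesis cab : contractible_in R (fun x y : X => (x <= y)%O : Prop)
  (minimal_open a `|` minimal_open b : set X).
Hypothesis IH : link_determines_complement (qc_space a b).

Context (V : Type) (le : V -> V -> Prop) (K : set V) (i : X -> V).
Hypothesis le_refl : forall v, le v v.
Hypothesis le_trans : forall u v w, le u v -> le v w -> le u w.
Hypothesis Ki : forall x, K (i x).
Hypothesis i_le : forall x y, le (i x) (i y) <-> (x <= y)%O.
Hypothesis K_down : forall v x, K v -> le v (i x) -> exists y, v = i y.

Let i' (y : qc_space a b) : option V := omap i (val y : option X).

Let i_inj : injective i := embedding_inj i_le.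

(** The reduction takes place away from [c], so it can be performed inside of
    [K] with [c] removed. *)
Lemma qc_step_other (c : X) : c <> a -> c <> b -> maximal_point c ->
  (forall v x, K v -> (forall y, v <> i y) -> le (i x) v -> (x < c)%O) ->
  sphere_null R le S [set v | K v /\ forall x, v = i x -> (x < c)%O] ->
  sphere_null R le S (K `\ i c).
Proof.
move=> ca cb cmax K_up nE.
have imax e : e <> c -> maximal_point e ->
    forall v, (K `\ i c) v -> le (i e) v -> v = i e.
  move=> ec emax v [Kv _] ev.
  have [[y vy]|nv] := pselect (exists y, v = i y).
    by move: ev; rewrite vy => /i_le/emax ->.
  have : (e < c)%O by apply: K_up ev => // y vy; apply: nv; exists y.
  by move/ltW/emax => ce; case: ec.
have Kic e : e <> c -> (K `\ i c) (i e) by move=> ec; split=> // /i_inj.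
have ac : a <> c by move=> h; exact: ca.
have bc : b <> c by move=> h; exact: cb.
apply: (sphere_null_merge normalRS le_refl le_trans (Kic a ac) (Kic b bc)
  (imax a ac amax) (imax b bc bmax)).
  rewrite (_ : _ `&` _ = i @` (minimal_open a `|` minimal_open b)).
    exact: contractible_in_image i_le _ cab.
  apply/seteqP; split => v.
    move=> [[Kv _]] /= [va|vb].
      have [y yv] := K_down Kv va; exists y => //.
      by left; apply/i_le; rewrite -yv.
    have [y yv] := K_down Kv vb; exists y => //.
    by right; apply/i_le; rewrite -yv.
  move=> [x [] /= xab <-].
    split; last by left; apply/i_le.
    by apply: Kic => xc; apply: ca; apply/esym/cmax; rewrite -xc.
  split; last by right; apply/i_le.
  by apply: Kic => xc; apply: cb; apply/esym/cmax; rewrite -xc.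
set D := [set v | _].
have Ddown u v : le u v -> D v -> D u.
  by move=> uv [va|vb]; [left|right]; exact: le_trans uv _.
pose K' := [set v | if v is Some v then [/\ K v, v <> i a & v <> i b] else True].
have [c' vc'] := qc_space_some ca cb.
rewrite (_ : [set v | _] = K' `\ i' c'); last first.
  rewrite /i' vc'; apply/seteqP; split => -[v|] //=.
    by move=> [[Kv vc] va vb]; split=> // -[].
  by move=> [[Kv va vb] vc]; split=> //; split=> // vc0; apply: vc; rewrite vc0.
apply: IH.
- exact: adjoin_le_refl.
- exact: adjoin_le_trans.
- move=> y; rewrite /i'; have [->//|[x [-> xa xb]]] := qc_space_cases y.
  by split => //= /i_inj.
- move=> y z; rewrite qc_space_le /i'.
  have [->|[x [-> xa xb]]] := qc_space_cases y;
  have [->|[x' [-> xa' xb']]] := qc_space_cases z => //=.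
  split=> [[/i_le ->//|/i_le ->]|/orP[|] h]; first by rewrite orbT.
    by left; apply/i_le.
  by right; apply/i_le.
- have im u y : [/\ K u, u <> i a & u <> i b] -> u = i y ->
      exists y0 : qc_space a b, Some u = i' y0.
    move=> [Ku ua ub] uy.
    have [||y0 y0y] := @qc_space_some _ _ a b y.
    + by move=> ya; apply: ua; rewrite uy ya.
    + by move=> yb; apply: ub; rewrite uy yb.
    by exists y0; rewrite /i' y0y uy.
  move=> [u|] x /=.
    move=> Ku; rewrite /i'; have [->|[z [-> za zb]]] := qc_space_cases x => /=.
      have [Ku' _ _] := Ku.
      by move=> [ua|ub]; [have [y uy] := K_down Ku' ua|have [y uy] := K_down Ku' ub];
        exact: im uy.
    by move=> uz; have [Ku' _ _] := Ku; have [y uy] := K_down Ku' uz; exact: im uy.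
  move=> _ _; have [y0 y0N] := qc_space_none a b.
  by exists y0; rewrite /i' y0N.
- move=> [u|] x /=; last first.
    have [y0 y0N] := qc_space_none a b.
    by move=> _ /(_ y0); rewrite /i' y0N.
  move=> [Ku ua ub] nu; rewrite {1}/i'.
  have [->//|[z [xz za zb]]] := qc_space_cases x; rewrite xz /= => zu.
  rewrite (qc_space_lt xz vc'); apply: K_up zu => // y uy.
  have ya : y <> a by move=> ya; apply: ua; rewrite uy ya.
  have yb : y <> b by move=> yb; apply: ub; rewrite uy yb.
  have [y0 y0y] := qc_space_some ya yb.
  by apply: (nu y0); rewrite /i' y0y uy.
- move=> y; rewrite qc_space_le vc'.
  have [->|[z [yz za zb]]] := qc_space_cases y => /=.
    by move=> /orP[/cmax/esym//|/cmax/esym//].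
  rewrite yz => /cmax zc; apply: val_inj.
  by rewrite yz zc vc'.
have nNone : ~ (forall x, None = i' x -> (x < c')%O).
  have [y0 y0N] := qc_space_none a b.
  by move=> /(_ y0); rewrite {1}/i' y0N => /(_ erefl) /ltW;
    rewrite qc_space_le y0N vc'.
apply: (sphere_null_iso (h := Some) (k := odflt (i a))) nE => //.
- move=> v [Kv vc]; split=> [|y].
    split=> // vab; first by have := vc _ vab; move=> /ltW/amax.
    by have := vc _ vab; move=> /ltW/bmax.
  rewrite /i'; have [->//|[z [yz za zb]]] := qc_space_cases y.
  by rewrite yz => -[] /vc; rewrite (qc_space_lt yz vc').
- move=> [u|] /=; last by move=> [_ /nNone].
  move=> [[Ku ua ub] uc]; split=> // x ux.
  have xa : x <> a by move=> xa; apply: ua; rewrite ux xa.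
  have xb : x <> b by move=> xb; apply: ub; rewrite ux xb.
  have [y0 y0x] := qc_space_some xa xb.
  by rewrite -(qc_space_lt y0x vc'); apply: uc; rewrite /i' y0x ux.
- by move=> [u|] //= [_ /nNone].
- by move=> [u|] [v|] //= _ [_ /nNone].
Qed.


(** With [c] removed, the point [e] it was merged with becomes one more point
    attached over the link of the merged point. By induction the complement of
    [c] reduces to this link with [e] attached, and the cone below [e] meets
    [L_c] in a contractible set. The new point is placed strictly above [a] and
    [b] so that [e] remains outside of its down-set. *)
Lemma qc_step_self (c e : X) : (c = a /\ e = b) \/ (c = b /\ e = a) ->
  (forall v x, K v -> (forall y, v <> i y) -> le (i x) v -> (x < c)%O) ->
  sphere_null R le S [set v | K v /\ forall x, v = i x -> (x < c)%O] ->
  sphere_null R le S (K `\ i c).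
Proof.
move=> ceab K_up nE.
have ce : c <> e by case: ceab => -[-> ->] // h; exact: ab.
have cmax : maximal_point c by case: ceab => -[->].
have emax : maximal_point e by case: ceab => -[_ ->].
have le_ab x : (x <= a)%O || (x <= b)%O <-> (x <= c)%O \/ (x <= e)%O.
  by case: ceab => -[-> ->]; split=> [/orP[]|[]] h; rewrite ?h ?orbT //; auto.
have ne_ab x : x <> c -> x <> e -> x <> a /\ x <> b.
  by case: ceab => -[-> ->].
have ne_ce x : x <> a -> x <> b -> x <> c /\ x <> e.
  by case: ceab => -[-> ->].
have [n0 n0N] := qc_space_none a b.
pose sb u v := le u v /\ ~ le v u.
have sb_trans u v w : le u v -> sb v w -> sb u w.
  move=> uv [vw nwv]; split; first exact: le_trans uv vw.
  by move=> wu; apply: nwv; exact: le_trans wu uv.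
pose D := [set v | sb v (i a) \/ sb v (i b)].
have Ddown u v : le u v -> D v -> D u.
  by move=> uv [va|vb]; [left|right]; exact: sb_trans uv _.
pose K' := [set v | if v is Some v then K v /\ v <> i c else True].
have K'n0 : sphere_null R (adjoin_le le D) S (K' `\ i' n0) ->
    sphere_null R le S (K `\ i c).
  rewrite {1}/i' n0N.
  apply: (sphere_null_iso (h := odflt (i a)) (k := Some)).
  - by move=> [v|] /= [Kv nv]; [exact: Kv|case: nv].
  - by move=> v Kv; split.
  - by [].
  - by move=> [u|] [v|] // [_ nu] [_ nv] //= _; case: nv.
  - by [].
apply: K'n0; apply: IH.
- exact: adjoin_le_refl.
- exact: adjoin_le_trans.
- move=> y; rewrite /i'; have [->//|[x [-> xa xb]]] := qc_space_cases y.
  by have [xc _] := ne_ce x xa xb; split => //= /i_inj.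
- move=> y z; rewrite qc_space_le /i'.
  have [->|[x [-> xa xb]]] := qc_space_cases y;
  have [->|[x' [-> xa' xb']]] := qc_space_cases z => //=.
  split=> [[[/i_le ->//]|[/i_le ->]]|/orP[|] h]; first by rewrite orbT.
    by left; split; [exact/i_le|move=> /i_le/amax].
  by right; split; [exact/i_le|move=> /i_le/bmax].
- have im u y : u = i y -> y <> a -> y <> b ->
      exists y0 : qc_space a b, Some u = i' y0.
    move=> uy ya yb; have [y0 y0y] := qc_space_some ya yb.
    by exists y0; rewrite /i' y0y uy.
  move=> [u|] x /=; last by exists n0; rewrite /i' n0N.
  move=> [Ku uc]; rewrite /i'.
  have [->|[z [-> za zb]]] := qc_space_cases x => /=.
    move=> [[ua nau]|[ub nbu]].
      have [y uy] := K_down Ku ua; apply: (im _ _ uy) => yab.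
        by apply: nau; rewrite uy yab.
      move: ua; rewrite uy yab => /i_le/bmax ba; exact: ab.
    have [y uy] := K_down Ku ub; apply: (im _ _ uy) => yab.
      by move: ub; rewrite uy yab => /i_le/amax ba; apply: ab.
    by apply: nbu; rewrite uy yab.
  move=> uz; have [y uy] := K_down Ku uz; apply: (im _ _ uy) => yab.
    by apply: za; apply/amax/i_le; rewrite -yab -uy.
  by apply: zb; apply/bmax/i_le; rewrite -yab -uy.
- move=> [u|] x /=; last by move=> _ /(_ n0); rewrite /i' n0N.
  move=> [Ku uc] nu; rewrite {1}/i'.
  have [->//|[z [xz za zb]]] := qc_space_cases x; rewrite xz /= => zu.
  rewrite (qc_space_lt_none xz n0N); apply/le_ab.
  have [[y uy]|nuy] := pselect (exists y, u = i y).
    have zy : (z <= y)%O by apply/i_le; rewrite -uy.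
    have [ye|ye] := pselect (y = e); first by right; rewrite -ye.
    have yc : y <> c by move=> yc; apply: uc; rewrite uy yc.
    have [ya yb] := ne_ab y yc ye.
    have [y0 y0y] := qc_space_some ya yb.
    by case: (nu y0); rewrite /i' y0y uy.
  left; apply: ltW; apply: K_up zu => // y uy; by apply: nuy; exists y.
- move=> y; rewrite qc_space_le n0N.
  have [y0|[z [-> //]]] := qc_space_cases y.
  by move=> _; apply: val_inj; rewrite y0 n0N.
pose Z := [set v | [/\ K v, v <> i c &
  forall z, v = i z -> (z <= c)%O \/ (z <= e)%O]].
have ltc z : (z <= c)%O -> (z <= e)%O -> (z < c)%O.
  move=> zc ze; rewrite lt_neqAle zc andbT; apply/eqP => zec.
  by apply: ce; apply/esym/cmax; rewrite -zec.
have nZ : sphere_null R le S Z.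
  apply: (sphere_null_cone le_refl le_trans (b := i e) normalS _ _ _ _ _ nE).
  - move=> v [Kv vc]; split=> //; first by move=> /vc; rewrite ltxx.
    by move=> z /vc/ltW zc; left.
  - split=> //; first by move=> /i_inj ec; exact: ce.
    by move=> z /i_inj <-; right.
  - move=> u v [Ku uc uz] [Kv vc] uv; split=> // z uiz.
    have [[y vy]|nvy] := pselect (exists y, v = i y).
      apply: le_lt_trans (vc y vy).
      by apply/i_le; rewrite -uiz -vy.
    apply: (K_up v) => //; last by rewrite -uiz.
    by move=> y vy; apply: nvy; exists y.
  - move=> v [Kv vc vz].
    have [ve|nve] := pselect (le v (i e)); first by right.
    left; split=> // z viz; rewrite lt_neqAle; apply/andP; split.
      by apply/eqP => zc; apply: vc; rewrite viz zc.
    by have [//|ze] := vz z viz; case: nve; rewrite viz; apply/i_le.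
  - rewrite (_ : _ `&` _ = i @` ((minimal_open a `|` minimal_open b : set X)
      `&` [set x | (x <= c)%O /\ (x <= e)%O])).
      apply: contractible_in_image => //; apply: contractible_cap cab.
      + by have /le_ab/orP : (c <= c)%O \/ (c <= e)%O by left.
      + by have /le_ab/orP : (e <= c)%O \/ (e <= e)%O by right.
      + by apply/negP => /cmax ec; exact: ce.
      + by apply/negP => /emax ec; exact: ce.
      + by move=> x xab; apply/le_ab/orP.
    apply/seteqP; split => v.
      move=> [[Kv vc] /= ve]; have [y vy] := K_down Kv ve.
      have yc := vc y vy; have ye : (y <= e)%O by apply/i_le; rewrite -vy.
      exists y => //; split; last by split=> //; exact: ltW.
      by apply/orP/le_ab; right.
    move=> [x [_ [xc xe] <-]]; split; last exact/i_le.
    by split=> // z /i_inj <-; exact: ltc.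
have nNone : ~ (forall x, None = i' x -> (x < n0)%O).
  by move=> /(_ n0); rewrite {1}/i' n0N => /(_ erefl); rewrite ltxx.
apply: (sphere_null_iso (h := Some) (k := odflt (i a))) nZ => //.
- move=> v [Kv vc vz]; split=> // y.
  rewrite /i'; have [->//|[z [yz za zb]]] := qc_space_cases y.
  by rewrite yz => -[] /vz zce; rewrite (qc_space_lt_none yz n0N); exact/le_ab.
- move=> [u|] /=; last by move=> [_ /nNone].
  move=> [[Ku uc] uy]; split=> // z uz.
  have [->|ze] := pselect (z = e); first by right.
  have zc : z <> c by move=> zc; apply: uc; rewrite uz zc.
  have [za zb] := ne_ab z zc ze.
  have [y0 y0z] := qc_space_some za zb.
  by apply/le_ab; rewrite -(qc_space_lt_none y0z n0N); apply: uy;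
    rewrite /i' y0z uz.
- by move=> [u|] //= [_ /nNone].
- by move=> [u|] [v|] //= _ [_ /nNone].
Qed.

End QcStep.

Lemma link_determines_complement_qc_step d (X : finPOrderType d) (a b : X) :
  maximal_point a -> maximal_point b -> a <> b ->
  contractible_in R (fun x y : X => (x <= y)%O : Prop)
    (minimal_open a `|` minimal_open b : set X) ->
  link_determines_complement (qc_space a b) -> link_determines_complement X.
Proof.
move=> amax bmax ab cab IH V le K i c lr lt Ki i_le K_down K_up cmax.
have [ca|ca] := pselect (c = a).
  by apply: (qc_step_self amax bmax ab cab IH lr lt Ki i_le K_down _ K_up); left.
have [cb|cb] := pselect (c = b).
  by apply: (qc_step_self amax bmax ab cab IH lr lt Ki i_le K_down _ K_up); right.
exact: (qc_step_other amax bmax cab IH lr lt Ki i_le K_down ca cb cmax K_up).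
Qed.

Lemma qc_reducible_link_determines_complement d (X : finPOrderType d) :
  qc_reducible R X -> link_determines_complement X.
Proof.
move=> [_ [Z XZ mZ]]; elim: XZ mZ => {X Z} [X|X Y Z XY _ IH] mZ.
  exact: link_determines_complement_max.
have {IH} := IH mZ; case: XY => {}X a b _ amax bmax /eqP ab cab.
apply: link_determines_complement_qc_step => //.
exact: contractible_contractible_in cab.
Qed.

End LinkDeterminesComplement.

(** * Reduced walks in a graph *)

Section Walks.
Context (d : Order.disp_t) (X : finPOrderType d).
Local Open Scope order_scope.
Local Open Scope classical_set_scope.
Implicit Types (u v x y m : X) (w z : seq X).

Context (G : set X) (x0 : X).
Hypothesis G_height : forall u v m, G u -> G v -> G m -> u < v -> v < m -> False.
Hypothesis Gx0 : G x0.

(** Walks are listed from their end to their origin [x0]. Consecutive points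
    are comparable and no edge is traversed back and forth: these are the
    vertices of the universal cover of the graph [G]. *)
Fixpoint reduced_walk w : Prop :=
  match w with
  | [::] => False
  | v :: w' => G v /\
      match w' with
      | [::] => v = x0
      | u :: w'' => [/\ v < u \/ u < v, ohead w'' <> Some v & reduced_walk w']
      end
  end.

Definition walk_end w := head x0 w.

Definition walk_step w u :=
  if walk_end w == u then w
  else if ohead (behead w) == Some u then behead w else u :: w.

Lemma reduced_walk_end w : reduced_walk w -> G (walk_end w).
Proof. by case: w => // v w []. Qed.

Lemma walk_step_end w u : walk_end (walk_step w u) = u.
Proof.
rewrite /walk_step; case: eqVneq => // _; case: eqP => //.
by case: w => [|v [|u' w]] //= [].
Qed.

Lemma walk_step_id w : walk_step w (walk_end w) = w.
Proof. by rewrite /walk_step eqxx. Qed.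

Lemma reduced_walk_step w u : reduced_walk w -> G u ->
  walk_end w < u \/ u <= walk_end w -> reduced_walk (walk_step w u).
Proof.
move=> rw Gu wu; rewrite /walk_step; case: eqVneq => // nwu.
case: w rw wu nwu => [//|v w] rw /= vu nvu.
case: eqP => [|nw]; first by case: w rw => [|u' w] //= [_ [_ _]].
by split=> //; split=> //; case: vu => [|uv]; [right|left; rewrite lt_neqAle eq_sym nvu].
Qed.

(** Stepping back cancels the last step; this is where walks have to be
    reduced. *)
Lemma walk_step_back w u : reduced_walk w -> walk_end w != u ->
  walk_step (walk_step w u) (walk_end w) = w.
Proof.
rewrite {2}/walk_step => rw /negbTE nwu; rewrite nwu.
case: w rw nwu => [//|v w] rw /= /negbT vu.
case: eqP => [|nw]; last by rewrite /walk_step /= eq_sym (negbTE vu) eqxx.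
case: w rw => [|u' w] //= rw [u'u]; subst u'.
rewrite /walk_step /= eq_sym (negbTE vu).
by case: rw => _ [_ /eqP/negbTE -> _].
Qed.

(** The order that makes [walk_end] a covering map. *)
Definition walk_le w w' :=
  w = w' \/ (walk_end w < walk_end w' /\ w' = walk_step w (walk_end w')).

Lemma walk_le_refl w : walk_le w w.
Proof. by left. Qed.

Lemma walk_le_end w w' : walk_le w w' -> walk_end w <= walk_end w'.
Proof. by move=> [->|[/ltW]]. Qed.

Lemma walk_step_le w w' m : reduced_walk w -> reduced_walk w' -> G m ->
  walk_le w w' -> walk_end w' <= m -> walk_step w m = walk_step w' m.
Proof.
move=> rw rw' Gm [->//|[ww' ew']] w'm.
have -> : m = walk_end w'.
  apply/eqP; rewrite eq_sym; apply: contraT => nm.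
  by case: (G_height (reduced_walk_end rw) (reduced_walk_end rw') Gm ww');
     rewrite lt_neqAle nm.
by rewrite -ew' walk_step_id.
Qed.

(** Within the star of [m] a walk can be continued through [m] to any other
    point, and the result depends monotonically on the walk and on that point.
    *)
Lemma walk_step2_le w w' m v v' : reduced_walk w -> reduced_walk w' -> G m ->
  G v -> G v' -> walk_le w w' -> walk_end w' <= m -> v <= v' -> v' <= m ->
  walk_le (walk_step (walk_step w m) v) (walk_step (walk_step w' m) v').
Proof.
move=> rw rw' Gm Gv Gv' ww' w'm vv' v'm.
rewrite (walk_step_le rw rw' Gm ww' w'm).
have [<-|vv] := eqVneq v v'; first exact: walk_le_refl.
have {vv}vv' : v < v' by rewrite lt_neqAle vv.
have v'E : v' = m.
  apply/eqP; apply: contraT => nm.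
  by case: (G_height Gv Gv' Gm vv'); rewrite lt_neqAle nm.
subst v'; set z := walk_step w' m.
have ze : walk_end z = m by exact: walk_step_end.
have rz : reduced_walk z.
  apply: reduced_walk_step => //; case: (eqVneq (walk_end w') m) => [->|n].
    by right.
  by left; rewrite lt_neqAle n.
have -> : walk_step z m = z by rewrite -ze walk_step_id.
right; rewrite walk_step_end ze; split=> //.
by rewrite -{1}ze walk_step_back// ze gt_eqF.
Qed.

Definition has_below v := exists2 u, G u & u < v.

Lemma has_below_lt u v : G u -> G v -> u < v -> ~ has_below u.
Proof. by move=> Gu Gv uv [m Gm mu]; exact: (G_height Gm Gu Gv mu uv). Qed.

Lemma walk_lt_cases w w' : walk_end w < walk_end w' ->
  w' = walk_step w (walk_end w') -> w' = behead w \/ w' = walk_end w' :: w.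
Proof.
move=> ww'; rewrite /walk_step lt_eqF//.
by case: eqP => _; [left|right].
Qed.

Lemma reduced_walk_behead w : reduced_walk w -> (1 < size w)%N ->
  [/\ reduced_walk (behead w), size (behead w) = (size w).-1,
      has_below (walk_end w) -> walk_end (behead w) < walk_end w &
      ~ has_below (walk_end w) -> walk_end w < walk_end (behead w)].
Proof.
case: w => [|v [|u w]] //= [Gv [vu _ [Gu rw]]] _; split=> //.
- by case: vu => // vu [m Gm mv]; case: (G_height Gm Gv Gu mv vu).
- by case: vu => // uv; case; exists u.
Qed.

Context (R : realType) (S : topologicalType).
Local Notation leX := (fun x y : X => x <= y : Prop).

Section Truncate.
Variables (M : nat) (g : S -> seq X).
Hypothesis M_gt1 : (1 < M)%N.
Hypothesis g_cont : lower_cont walk_le g.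
Hypothesis g_red : forall s, reduced_walk (g s).
Hypothesis g_size : forall s, (size (g s) <= M)%N.

Let end_cont (h : S -> seq X) : lower_cont walk_le h ->
  lower_cont leX (fun s => walk_end (h s)).
Proof. by move=> ch s; apply: filterS (ch s) => y; exact: walk_le_end. Qed.

(** The longest walks are shortened by one step, first the ones that end at an
    upper point and then the ones that end at a lower point. The first
    operation lowers the map and the second one raises it, so both are
    homotopies. *)
Let trunc1 s := if `[< size (g s) = M /\ has_below (walk_end (g s)) >]
  then behead (g s) else g s.

Let trunc1_red s : reduced_walk (trunc1 s).
Proof.
rewrite /trunc1; case: asboolP => // -[sM _].
by have [] := reduced_walk_behead (g_red s); rewrite ?sM.
Qed.

Let trunc1_size s : (size (trunc1 s) <= M)%N.
Proof.
rewrite /trunc1; case: asboolP => // -[sM _].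
by rewrite size_behead sM leq_pred.
Qed.

Let trunc1_top s : size (trunc1 s) = M -> ~ has_below (walk_end (trunc1 s)).
Proof.
rewrite /trunc1; case: asboolP => [[sM _]|nb].
  by rewrite size_behead sM; case: M M_gt1 => // k _ /= /n_Sn.
by move=> sM hb; exact: nb.
Qed.

Let trunc1_cont : lower_cont walk_le trunc1.
Proof.
move=> s; apply: filterS (g_cont s) => y [gE|[gys gE]].
  by left; rewrite /trunc1 gE.
have nb := has_below_lt (reduced_walk_end (g_red y))
  (reduced_walk_end (g_red s)) gys.
have -> : trunc1 y = g y by rewrite /trunc1 asboolF// => -[].
rewrite /trunc1; case: asboolP => [[sM _]|_]; last by right.
have [gb|->] := walk_lt_cases gys gE; last exact: walk_le_refl.
have := g_size y; rewrite -sM gb size_behead.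
by have := g_red y; case: (g y) => //= v w _; rewrite ltnn.
Qed.

Let trunc2 s := if `[< size (trunc1 s) = M >]
  then behead (trunc1 s) else trunc1 s.

Let trunc2_red s : reduced_walk (trunc2 s).
Proof.
rewrite /trunc2; case: asboolP => // sM.
by have [] := reduced_walk_behead (trunc1_red s); rewrite ?sM.
Qed.

Let trunc2_size s : (size (trunc2 s) <= M.-1)%N.
Proof.
rewrite /trunc2; case: asboolP => [sM|/eqP sM].
  by rewrite size_behead sM.
by have := trunc1_size s; rewrite leq_eqVlt (negbTE sM) /=; case: M M_gt1.
Qed.

Let trunc2_cont : lower_cont walk_le trunc2.
Proof.
move=> s; apply: filterS (trunc1_cont s) => y [gE|[gys gE]].
  by left; rewrite /trunc2 gE.
have hb : has_below (walk_end (trunc1 s)).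
  by exists (walk_end (trunc1 y)) => //; exact: reduced_walk_end.
have -> : trunc2 s = trunc1 s.
  by rewrite /trunc2 asboolF// => /trunc1_top; apply.
rewrite /trunc2; case: asboolP => [sM|_]; last by right.
have [<-|gs] := walk_lt_cases gys gE; first exact: walk_le_refl.
have := trunc1_size s; rewrite gs /= sM ltnn; by [].
Qed.

Lemma walk_truncate : exists h : S -> seq X,
  [/\ lower_cont walk_le h, forall s, reduced_walk (h s),
      forall s, (size (h s) <= M.-1)%N &
      homotopic R leX (fun=> G) (fun s => walk_end (g s)) (fun s => walk_end (h s))].
Proof.
exists trunc2; split => //.
have leX_trans : forall u v w : X, leX u v -> leX v w -> leX u w.
  by move=> u v w; exact: le_trans.
apply: (@homotopic_trans _ _ _ _ _ _ (fun s => walk_end (trunc1 s))).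
  apply: homotopic_sym; apply: homotopic_le => //.
  - exact: end_cont.
  - exact: end_cont.
  - by move=> s; exact: reduced_walk_end.
  - by move=> s; exact: reduced_walk_end.
  - move=> s; rewrite /trunc1; case: asboolP => // -[sM hb].
    have [|_ _ /(_ hb)/ltW//] := reduced_walk_behead (g_red s).
    by rewrite sM.
apply: homotopic_le => //.
- exact: end_cont.
- exact: end_cont.
- by move=> s; exact: reduced_walk_end.
- by move=> s; exact: reduced_walk_end.
- move=> s; rewrite /trunc2; case: asboolP => // sM.
  have [|_ _ _ /(_ (trunc1_top sM))/ltW//] := reduced_walk_behead (trunc1_red s).
  by rewrite sM.
Qed.

End Truncate.

(** A map into the universal cover is null-homotopic once the walks have
    bounded length: they are shortened until only the trivial walk is left. *)
Lemma walks_null (M : nat) (g : S -> seq X) : lower_cont walk_le g ->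
  (forall s, reduced_walk (g s)) -> (forall s, (size (g s) <= M)%N) ->
  homotopic R leX (fun=> G) (fun s => walk_end (g s)) (fun=> x0).
Proof.
elim: M g => [|[_|M IH]] g cg rg sg.
- have gE : (fun s => walk_end (g s)) = (fun=> x0).
    by apply/funext => s; have := sg s; have := rg s; case: (g s).
  rewrite gE; apply: homotopic_refl => //.
  + by move=> u v w; exact: le_trans.
  + by move=> s; apply: nearW => y.
- have gE : (fun s => walk_end (g s)) = (fun=> x0).
    apply/funext => s; have := sg s; have := rg s.
    by case: (g s) => [//|v [|]] // [_ ->].
  rewrite gE; apply: homotopic_refl => //.
  + by move=> u v w; exact: le_trans.
  + by move=> s; apply: nearW => y.
- have [h [ch rh sh gh]] := @walk_truncate M.+2 g isT cg rg sg.
  exact: homotopic_trans gh (IH h ch rh sh).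
Qed.

End Walks.

(** * A sphere as a collapsed normed space *)

Section Sphere.
Context (R : realType) (V : normedModType R).
Implicit Types (x y : V).

Definition bump x : R := Num.max 0 (1 - `|x|).

(** The map [collapse] is injective on the open unit ball and constant outside
    of it, so the topology it induces on [V] is the one of the ball with its
    boundary collapsed to a point. This makes [sphere] a pseudometric space
    whose points are vectors. *)
Definition collapse x : R * V := (bump x, bump x *: x).

Definition sphere : Type := initial_topology collapse.

HB.instance Definition _ := PseudoMetric.on sphere.

Lemma sphere_normal : normal_space sphere.
Proof. exact: (@pseudometric_normal R). Qed.

Lemma sphere_cylinder_normal : normal_space (R * sphere)%type.
Proof. exact: (@pseudometric_normal R). Qed.

Lemma bump_continuous : continuous bump.
Proof.
move=> x; apply: (@continuous_max R V (fun=> 0) (fun x => 1 - `|x|)).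
  exact: cvg_cst.
by apply: cvgB; [exact: cvg_cst|exact: norm_continuous].
Qed.

Lemma bump_scale0_or_lt1 x : bump x *: x = 0 \/ `|x| < 1.
Proof.
have [|x1] := ltP `|x| 1; first by right.
by left; rewrite /bump max_l ?scale0r// subr_le0.
Qed.

Lemma bump0 x : 1 <= `|x| -> bump x = 0.
Proof. by move=> x1; rewrite /bump max_l// subr_le0. Qed.

Lemma bump_gt0 x : `|x| < 1 -> 0 < bump x.
Proof. by move=> x1; rewrite /bump lt_max subr_gt0 x1 orbT. Qed.

Lemma collapse_continuous : continuous collapse.
Proof.
move=> x; apply: (@cvg_pair _ _ _ _ (nbhs (bump x)) (nbhs (bump x *: x))).
  exact: bump_continuous.
by apply: cvgZ; [exact: bump_continuous|exact: cvg_id].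
Qed.

Lemma to_sphere_continuous : continuous (id : V -> sphere).
Proof.
apply: continuous_comp_initial; exact: collapse_continuous.
Qed.

Lemma of_sphere_continuous (x : V) : `|x| < 1 ->
  {for (x : sphere), continuous (id : sphere -> V)}.
Proof.
move=> x1.
have b0 := bump_gt0 x1.
pose k (w : R * V) := w.1^-1 *: w.2.
have kK y : `|y| < 1 -> k (collapse y) = y.
  by move=> /bump_gt0 y0; rewrite /k /= scalerA mulVf ?scale1r// gt_eqF.
have ck : {for collapse x, continuous k}.
  apply: cvgZ; last exact: cvg_snd.
  by apply: cvgV; [rewrite /= gt_eqF|exact: cvg_fst].
have cc : continuous (collapse : sphere -> R * V) by exact: initial_continuous.
have ckc : ((k \o (collapse : sphere -> R * V)) @ (x : sphere) --> x).
  by rewrite -{2}(kK x x1); apply: (continuous_comp (cc x)).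
have nb : \forall y \near (x : sphere), 0 < bump y.
  have : nbhs (collapse x) [set w : R * V | 0 < w.1].
    exact: (@cvg_fst _ _ (nbhs (bump x)) (nbhs (bump x *: x)) _ _ (lt_nbhsr b0)).
  exact: (cc x).
move=> A /= xA; have := ckc A xA; apply: filterS2 nb => y yb.
rewrite /= kK //.
by rewrite ltNge; apply/negP => /bump0 yb0; move: yb; rewrite yb0 ltxx.
Qed.

(** The neighbourhoods of the collapsed point contain the complement of a ball
    of radius less than 1, as [bump] is small only near the unit sphere. *)
Lemma sphere_near_infinity (x : V) (A : set V) : 1 <= `|x| ->
  (\forall y \near (x : sphere), A y) <->
  exists2 r, r < 1 & forall y, r < `|y| -> A y.
Proof.
move=> x1.
have cc : continuous (collapse : sphere -> R * V) by exact: initial_continuous.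
have cx : collapse x = (0, 0) by rewrite /collapse bump0// scale0r.
split=> [[B [[C oC CB] Bx] BA]|[r r1 rA]].
  have Cx : C (0, 0) by rewrite -cx; move: Bx; rewrite -CB.
  have : nbhs (0 : R, 0 : V) C by exact: open_nbhs_nbhs.
  move=> /nbhs_ballP[e /= e0 eC].
  exists (1 - e); first lra.
  move=> y ye; apply: BA; rewrite -CB; apply: eC.
  have by_e : `|bump y| < e.
    rewrite ger0_norm; last by rewrite /bump le_max lexx.
    by rewrite /bump gt_max e0 /=; lra.
  split; rewrite /= -ball_normE /= sub0r normrN//.
  have [->|y1] := bump_scale0_or_lt1 y; first by rewrite normr0.
  by rewrite normrZ (le_lt_trans _ by_e)// ler_piMr// ltW.
have nr : nbhs (collapse x) [set w : R * V | w.1 < 1 - r].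
  rewrite cx; apply: (@cvg_fst _ _ (nbhs 0) (nbhs (0 : V)) _ _ (lt_nbhsl _)).
  by rewrite subr_gt0.
have nb : \forall y \near (x : sphere), bump y < 1 - r by exact: (cc x _ nr).
apply: filterS nb => y; rewrite /bump gt_max => /andP[_ yr].
by apply: rA; lra.
Qed.

Lemma lower_cont_sphere T (le : T -> T -> Prop) (f : V -> T) :
  lower_cont le (f : sphere -> T) <->
  lower_cont le f /\ forall x, 1 <= `|x| ->
    exists2 r, r < 1 & forall y, r < `|y| -> le (f y) (f x).
Proof.
split=> [cf|[cf finf] x].
  split; first exact: (lower_cont_comp to_sphere_continuous cf).
  by move=> x x1; apply/(sphere_near_infinity _ x1); exact: cf.
have [x1|x1] := ltP `|x| 1; last exact/(sphere_near_infinity _ x1)/finf.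
exact: (of_sphere_continuous x1 (cf x)).
Qed.

End Sphere.

(** * Lifting spheres in a graph to walks *)

Section Lifting.
Context (R : realType) (V : normedModType R).
Implicit Types (x y : V).

(** The complement of a ball is connected, in terms of locally constant maps.
    *)
Definition connected_at_infinity := forall (A : Type) (g : V -> A) (r : R),
  (forall x, r < `|x| -> \forall y \near x, g y = g x) ->
  forall x y, r < `|x| -> r < `|y| -> g x = g y.

Definition to_unit_ball x : V := (Num.max 1 `|x|)^-1 *: x.

Lemma to_unit_ball_norm x : `|to_unit_ball x| <= 1.
Proof.
have m0 : 0 < Num.max 1 `|x| by rewrite lt_max ltr01.
rewrite /to_unit_ball normrZ gtr0_norm ?invr_gt0//.
by rewrite mulrC ler_pdivrMr// mul1r le_max lexx orbT.
Qed.

Lemma to_unit_ball_id x : `|x| <= 1 -> to_unit_ball x = x.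
Proof. by move=> x1; rewrite /to_unit_ball max_l// invr1 scale1r. Qed.

Lemma to_unit_ball_out x : 1 <= `|x| -> `|to_unit_ball x| = 1.
Proof.
move=> x1; have x0 : 0 < `|x| by exact: lt_le_trans x1.
rewrite /to_unit_ball max_r// normrZ gtr0_norm ?invr_gt0//.
by rewrite mulVf// gt_eqF.
Qed.

Lemma to_unit_ball_continuous : continuous to_unit_ball.
Proof.
move=> x; apply: cvgZ; last exact: cvg_id.
apply: cvgV; first by rewrite gt_eqF// lt_max ltr01.
apply: (@continuous_max R V (fun=> 1) (fun x => `|x|)); first exact: cvg_cst.
exact: norm_continuous.
Qed.

Hypothesis unit_ball_compact : compact [set x : V | `|x| <= 1].

Context (d : Order.disp_t) (X : finPOrderType d) (G : set X).
Local Notation leX := (fun x y : X => (x <= y)%O : Prop).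
Hypothesis G_height : forall u v m, G u -> G v -> G m ->
  (u < v)%O -> (v < m)%O -> False.

Variable (f : V -> X).
Hypothesis f_cont : lower_cont leX f.
Hypothesis Gf : forall x, G (f x).

Lemma uniform_upper_bound : exists2 e : R, 0 < e & forall y, `|y| <= 1 ->
  exists2 m, G m & forall z, `|z - y| < e -> (f z <= m)%O.
Proof.
have /compact_near_coveringP cK := unit_ball_compact.
have [|e /= e0 He] := cK R (0^'+ : set_system R)
  (fun e y => exists2 m, G m & forall z, `|z - y| < e -> (f z <= m)%O) _.
  move=> x _; have /nbhs_ballP[e /= e0 eB] := f_cont x.
  exists (ball x (e / 2), [set t | t < e / 2]).
    split; first by apply: nbhsx_ballx; exact: divr_gt0.
    by apply: nbhs_right_lt; exact: divr_gt0.
  move=> [y t] [/= xy te]; exists (f x) => // z zy; apply: eB.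
  move: xy; rewrite -!ball_normE /= => xy.
  rewrite (splitr e) (le_lt_trans (ler_distD y _ _))// ltrD//.
  by rewrite distrC (lt_trans zy).
exists (e / 2); first exact: divr_gt0.
apply: He; rewrite /= ?sub0r ?normrN ?gtr0_norm ?divr_gt0//.
by rewrite ltr_pdivrMr// ltr_pMr// ltr1n.
Qed.

(** Two upper bounds [m] and [m'] of the values of [f] on a segment may differ.
    Then the values are lower points of the graph, so [f] is constant on the
    segment, and stepping to [m] or [m'] and back has no effect. *)
Lemma walk_step2_indep (x0 : X) (w : seq X) (p q : V) (m m' : X) :
  G x0 -> reduced_walk G x0 w -> walk_end x0 w = f p -> G m -> G m' ->
  (forall t, 0 <= t <= 1 -> (f (p + t *: (q - p)) <= m)%O) ->
  (forall t, 0 <= t <= 1 -> (f (p + t *: (q - p)) <= m')%O) ->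
  walk_step x0 (walk_step x0 w m) (f q) =
  walk_step x0 (walk_step x0 w m') (f q).
Proof.
move=> Gx0 rw wp Gm Gm' fm fm'; have [->//|/eqP mm'] := eqVneq m m'.
have fpq : f q = f p.
  pose g t := f (p + clamp01 t *: (q - p)).
  have cg : lower_cont leX g.
    apply: (lower_cont_comp _ f_cont) => t.
    apply: cvgD; first exact: cvg_cst.
    by apply: cvgZ; [exact: clamp01_continuous|exact: cvg_cst].
  have clamp (t : R) : 0 <= clamp01 t <= 1 by rewrite clamp01_ge0 clamp01_le1.
  have lc t : \forall s \near t, g s = g t.
    apply: filterS (cg t) => s gst; apply/eqP; apply: contraT => ne.
    have lt_st : (g s < g t)%O by rewrite lt_neqAle ne.
    have top k : G k -> (g t <= k)%O -> g t = k.
      move=> Gk gk; apply/eqP; apply: contraT => nk.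
      by case: (G_height (Gf _) (Gf _) Gk lt_st); rewrite lt_neqAle nk.
    have gm := top m Gm (fm _ (clamp t)).
    by have gm' := top m' Gm' (fm' _ (clamp t)); case: mm'; rewrite -gm -gm'.
  have := locally_constant lc 1 0; rewrite /g.
  rewrite clamp01_ge1// clamp01_le0// scale1r scale0r addr0.
  by rewrite addrC subrK.
have idw k : walk_step x0 (walk_step x0 w k) (f q) = w.
  rewrite fpq -wp; have [->|nk] := eqVneq k (walk_end x0 w).
    by rewrite walk_step_id walk_step_id.
  by apply: (walk_step_back rw); rewrite eq_sym.
by rewrite !idw.
Qed.

(** The ray from 0 to [x] is divided into [n.+1] segments, so short that the
    values of [f] around each of them have an upper bound [M] in the graph. The
    lift of [x] follows these upper bounds along the ray. *)
Lemma walk_lift : (forall x, f (to_unit_ball x) = f x) ->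
  exists (x0 : X) (N : nat) (F : V -> seq X),
    [/\ G x0, lower_cont (walk_le x0) F, forall x, reduced_walk G x0 (F x),
        forall x, (size (F x) <= N)%N & forall x, walk_end x0 (F x) = f x].
Proof.
move=> f_ball; have [e e0 eP] := uniform_upper_bound.
have [n ne] : exists n : nat, n.+1%:R^-1 < e.
  have [n _ /(_ n (leqnn n)) Hn] := near_infty_natSinv_lt (PosNum e0).
  by exists n.
have [M MP] : exists M : V -> X, forall y, `|y| <= 1 ->
    G (M y) /\ forall z, `|z - y| < e -> (f z <= M y)%O.
  have [M MP] : {M : V -> X & forall y, `|y| <= 1 ->
      G (M y) /\ forall z, `|z - y| < e -> (f z <= M y)%O}.
    apply: (@choice _ _ (fun y m => `|y| <= 1 ->
      G m /\ forall z, `|z - y| < e -> (f z <= m)%O)) => y.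
    have [y1|y1] := pselect (`|y| <= 1); last by exists (f 0).
    by have [m Gm mP] := eP y y1; exists m.
  by exists M.
pose x0 := f 0.
have Gx0 : G x0 by exact: Gf.
pose pt k x := (k%:R / n.+1%:R) *: to_unit_ball x.
pose W := fix W k x := if k is k.+1 then
  walk_step x0 (walk_step x0 (W k x) (M (pt k x))) (f (pt k.+1 x)) else [:: x0].
have pt1 k x : (k <= n.+1)%N -> `|pt k x| <= 1.
  move=> kn; rewrite /pt normrZ ger0_norm; last by rewrite divr_ge0.
  rewrite -[leRHS]mulr1 ler_pM ?divr_ge0//; last exact: to_unit_ball_norm.
  by rewrite ler_pdivrMr// mul1r ler_nat.
have ptS k x t : 0 <= t <= 1 -> `|t *: (pt k.+1 x - pt k x)| < e.
  move=> /andP[t0 t1].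
  have -> : pt k.+1 x - pt k x = n.+1%:R^-1 *: to_unit_ball x.
    by rewrite /pt -scalerBl -mulrBl -natrB// subSnn mul1r.
  rewrite scalerA normrZ ger0_norm; last by rewrite mulr_ge0.
  apply: le_lt_trans ne; rewrite -[leRHS]mulr1.
  rewrite ler_pM ?mulr_ge0//; last exact: to_unit_ball_norm.
  by rewrite ler_piMl.
have seg k x t : (k <= n)%N -> 0 <= t <= 1 ->
    (f (pt k x + t *: (pt k.+1 x - pt k x)) <= M (pt k x))%O.
  move=> kn t01; have [_] := MP _ (pt1 k x (leqW kn)); apply.
  by rewrite addrC addKr; exact: ptS.
have seg0 k x : (k <= n)%N -> (f (pt k x) <= M (pt k x))%O.
  move=> kn; have := seg k x 0 kn; rewrite scale0r addr0; apply.
  by rewrite lexx ler01.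
have seg1 k x : (k <= n)%N -> (f (pt k.+1 x) <= M (pt k x))%O.
  move=> kn; have := seg k x 1 kn; rewrite scale1r addrC subrK; apply.
  by rewrite lexx ler01.
have We k x : (k <= n.+1)%N -> walk_end x0 (W k x) = f (pt k x).
  case: k => [|k] _ /=; last by rewrite walk_step_end.
  by rewrite /pt mul0r scale0r.
have Wr k x : (k <= n.+1)%N -> reduced_walk G x0 (W k x).
  elim: k => [|k IH] kn /=; first by split.
  have GM : G (M (pt k x)) by have [] := MP _ (pt1 k x (ltnW kn)).
  apply: (reduced_walk_step (reduced_walk_step (IH (ltnW kn)) GM _) (Gf _)).
    rewrite (We k x (ltnW kn)); have := seg0 k x kn; rewrite le_eqVlt.
    by move=> /orP[/eqP->|]; [right; exact: lexx|left].
  by right; rewrite walk_step_end; exact: seg1.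
have pt_cont k : continuous (pt k).
  move=> x; apply: cvgZ; first exact: cvg_cst.
  exact: to_unit_ball_continuous.
have Wc k : (k <= n.+1)%N -> lower_cont (walk_le x0) (W k).
  elim: k => [|k IH] kn; first by move=> x; apply: nearW => y; left.
  move=> x; have {}IH := IH (ltnW kn) x.
  have near_f : \forall y \near x, (f (pt k.+1 y) <= f (pt k.+1 x))%O.
    exact: (pt_cont k.+1 x _ (f_cont (pt k.+1 x))).
  have near_pt : \forall y \near x, `|pt k y - pt k x| < e - n.+1%:R^-1.
    by apply: cvgr_distC_lt; [exact: pt_cont|rewrite subr_gt0].
  apply: filterS3 IH near_f near_pt => y Wyx fyx ptyx /=.
  have [GMx MPx] := MP _ (pt1 k x (ltnW kn)).
  have [GMy _] := MP _ (pt1 k y (ltnW kn)).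
  rewrite (@walk_step2_indep x0 _ (pt k y) (pt k.+1 y) _ (M (pt k x)))//.
  - have [ry rx] := (Wr k y (ltnW kn), Wr k x (ltnW kn)).
    apply: (walk_step2_le G_height Gx0 ry rx GMx (Gf _) (Gf _) Wyx) => //.
    + by rewrite (We k x (ltnW kn)); exact: seg0.
    + exact: seg1.
  - exact: Wr (ltnW kn).
  - exact: We (ltnW kn).
  - by move=> t t01; exact: seg.
  - move=> t /andP[t0 t1]; apply: MPx.
    rewrite addrAC (le_lt_trans (ler_normD _ _))//.
    rewrite -(subrK n.+1%:R^-1 e) ltr_leD//.
    have -> : pt k.+1 y - pt k y = n.+1%:R^-1 *: to_unit_ball y.
      by rewrite /pt -scalerBl -mulrBl -natrB// subSnn mul1r.
    rewrite scalerA normrZ ger0_norm; last by rewrite mulr_ge0.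
    rewrite -[leRHS]mulr1 ler_pM ?mulr_ge0//; last exact: to_unit_ball_norm.
    by rewrite ler_piMl.
have Ws k x : (size (W k x) <= k.*2.+1)%N.
  elim: k => [//|k IH] /=.
  have ss w u : (size (walk_step x0 w u) <= (size w).+1)%N.
    rewrite /walk_step; case: ifP => // _; case: ifP => // _.
    by rewrite size_behead (leq_trans (leq_pred _)).
  by rewrite (leq_trans (ss _ _))// ltnS (leq_trans (ss _ _)).
exists x0, n.+1.*2.+1, (W n.+1); split => //.
- exact: Wc.
- by move=> x; exact: Wr.
- by move=> x; rewrite We// /pt divff ?scale1r// pnatr_eq0.
Qed.

End Lifting.

Section GraphSphere.
Context (R : realType) (V : normedModType R).
Hypothesis unit_ball_compact : compact [set x : V | `|x| <= 1].
Hypothesis V_connected : connected_at_infinity V.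
Context (d : Order.disp_t) (X : finPOrderType d) (G : set X).
Local Notation leX := (fun x y : X => (x <= y)%O : Prop).
Hypothesis G_height : forall u v m, G u -> G v -> G m ->
  (u < v)%O -> (v < m)%O -> False.

Lemma sphere_lower_cont_out (f : sphere V -> X) : lower_cont leX f ->
  forall x y : V, 1 <= `|x| -> 1 <= `|y| -> f x = f y.
Proof.
move=> /lower_cont_sphere[_ finf] x y x1 y1; apply/le_anti/andP; split.
  by have [r r1 rP] := finf y y1; apply: rP; exact: lt_le_trans x1.
by have [r r1 rP] := finf x x1; apply: rP; exact: lt_le_trans y1.
Qed.

(** The lift of [f] to walks is continuous also at the collapsed point: near it
    the values of [f] are below [f x], hence the walks continued to [f x] are
    locally constant there, and the complement of a ball is connected. *)
Lemma graph_sphere_null : sphere_null R leX (sphere V) G.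
Proof.
move=> f cf Gf.
have /lower_cont_sphere[cfV finf] := cf.
have f_ball (x : V) : f (to_unit_ball x) = f x.
  have [x1|x1] := leP `|x| 1; first by rewrite to_unit_ball_id.
  apply: (sphere_lower_cont_out cf); last exact: ltW.
  by rewrite to_unit_ball_out// ltW.
have [x0 [N [F [Gx0 cF rF sF Ff]]]] :=
  walk_lift unit_ball_compact G_height cfV Gf f_ball.
exists x0 => //.
have cFS : lower_cont (walk_le x0) (F : sphere V -> seq X).
  apply/lower_cont_sphere; split=> // x x1.
  have [r r1 rP] := finf x x1; exists r => // y ry.
  have step_const := @V_connected _ (fun y => walk_step x0 (F y) (f x)) r.
  have {}step_const : walk_step x0 (F y) (f x) = walk_step x0 (F x) (f x).
    apply: step_const => //; last exact: lt_le_trans x1.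
    move=> z rz; apply: filterS (cF z) => z' Fz'.
    apply: (walk_step_le G_height Gx0 (rF _) (rF _) (Gf x)) => //.
    by rewrite Ff; exact: rP.
  rewrite -[X in walk_le _ _ X](walk_step_id x0) Ff -step_const.
  have := rP y ry; rewrite le_eqVlt => /orP[/eqP fyx|fyx].
    by rewrite -fyx -Ff walk_step_id; left.
  by right; rewrite walk_step_end Ff.
have -> : f = fun s => walk_end x0 (F s) by apply/funext.
exact: (walks_null G_height Gx0 R cFS rF sF).
Qed.

End GraphSphere.

(** * Row vectors *)

Section RowVectors.
Context (R : realType) (n : nat).
Implicit Types (x y : 'rV[R]_n).

Lemma ler_coord_norm x i : `|x ord0 i| <= `|x|.
Proof.
rewrite [leRHS]/Num.Def.normr /= mx_normrE.
exact: (le_bigmax _ (fun ij : 'I_1 * 'I_n => `|x ij.1 ij.2|) (ord0, i)).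
Qed.

Lemma rV_norm_le x (c : R) : 0 <= c -> (forall i, `|x ord0 i| <= c) -> `|x| <= c.
Proof.
move=> c0 xc; rewrite [leLHS]/Num.Def.normr /= mx_normrE.
by apply: bigmax_le => //= -[i j] _ /=; rewrite (ord1 i).
Qed.

Lemma coord_gt_norm x (r : R) : (0 < n)%N -> r < `|x| ->
  exists i, r < `|x ord0 i|.
Proof.
move=> n0 rx; apply: contrapT => /forallNP nr.
have le_r i : `|x ord0 i| <= r by rewrite leNgt; apply/negP.
have r0 : 0 <= r by exact: le_trans (le_r (Ordinal n0)).
by move: rx; rewrite ltNge rV_norm_le.
Qed.

Lemma rV_unit_ball_compact : compact [set x : 'rV[R]_n | `|x| <= 1].
Proof.
apply: bounded_closed_compact.
  by exists 1; split => // M M1 x /= x1; rewrite (le_trans x1)// ltW.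
apply: (@closed_comp _ _ (fun x : 'rV[R]_n => `|x|) [set t | t <= 1]).
  by move=> x _; exact: norm_continuous.
exact: closed_le.
Qed.

(** If the coordinate [i] of [x] is large, the other coordinates can be changed
    to a large constant [c] first, and the coordinate [i] afterwards. This
    takes two coordinates. *)
Lemma rV_connected_at_infinity : (2 <= n)%N ->
  connected_at_infinity 'rV[R]_n.
Proof.
move=> n2 A g r lg.
have segment x y : (forall t, 0 <= t <= 1 -> r < `|x + t *: (y - x)|) ->
    g x = g y.
  move=> rxy; pose h t := g (x + clamp01 t *: (y - x)).
  have lh t : \forall s \near t, h s = h t.
    have rt : r < `|x + clamp01 t *: (y - x)|.
      by apply: rxy; rewrite clamp01_ge0 clamp01_le1.
    have ct : continuous (fun t : R => x + clamp01 t *: (y - x)).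
      move=> s; apply: cvgD; first exact: cvg_cst.
      by apply: cvgZ; [exact: clamp01_continuous|exact: cvg_cst].
    exact: (ct t _ (lg _ rt)).
  have := locally_constant lh 0 1; rewrite /h clamp01_le0// clamp01_ge1//.
  by rewrite scale0r addr0 scale1r addrC subrK.
pose c := `|r| + 1.
have rc : r < c by rewrite /c (le_lt_trans (ler_norm r))// ltrDl.
have c0 : 0 < c by rewrite /c ltr_wpDl.
suff toc x : r < `|x| -> g x = g (const_mx c).
  by move=> x y rx ry; rewrite toc// toc.
move=> rx; have [i ri] := coord_gt_norm (ltnW n2) rx.
have [j ij] : exists j : 'I_n, j != i.
  have [i0|i0] := eqVneq (i : nat) 0%N.
    by exists (Ordinal n2); apply/eqP => /(congr1 val) /=; rewrite i0.
  exists (Ordinal (ltnW n2)); apply/eqP => /(congr1 val) /= ii.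
  by move: i0; rewrite -ii.
pose y : 'rV[R]_n := \row_k (if k == i then x ord0 i else c).
rewrite (segment x y); last first.
  move=> t _; apply: lt_le_trans ri _; apply: le_trans (ler_coord_norm _ i).
  by rewrite !mxE eqxx subrr mulr0 addr0.
apply: segment => t _.
apply: lt_le_trans rc _; apply: le_trans (ler_coord_norm _ j).
by rewrite !mxE (negbTE ij) subrr mulr0 addr0 ger0_norm// ltW.
Qed.

Definition clamp_cube x : 'rV[R]_n := \row_i clamp01 (x ord0 i).

Lemma clamp_cube_in x : cube (clamp_cube x).
Proof. by move=> i; rewrite mxE clamp01_ge0 clamp01_le1. Qed.

Lemma clamp_cube_id x : cube x -> clamp_cube x = x.
Proof.
by move=> xI; apply/rowP => i; rewrite mxE clamp01_id.
Qed.

Lemma clamp01_lip (s t : R) : `|clamp01 s - clamp01 t| <= `|s - t|.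
Proof.
rewrite /clamp01 /Num.max /Num.min.
by repeat case: ifPn; rewrite -?leNgt => *; rewrite ler_norml;
  apply/andP; split; have := ler_norm (s - t); have := ler_norm (t - s);
  rewrite -[`|t - s|]distrC => *; lra.
Qed.

Lemma clamp_cube_continuous : continuous clamp_cube.
Proof.
move=> x; apply/(@cvgrPdist_lt _ _ _ (nbhs x) (nbhs_filter x)) => e e0.
have near_x : \forall y \near x, `|x - y| < e.
  by have := nbhsx_ballx x e e0; rewrite -ball_normE.
apply: filterS near_x => y; apply: le_lt_trans; apply: rV_norm_le => // i.
rewrite !mxE; apply: le_trans (clamp01_lip _ _) _.
by have := ler_coord_norm (x - y) i; rewrite !mxE.
Qed.

End RowVectors.

(** * From null spheres to homotopy groups *)

Lemma comp_continuous (S T U : topologicalType) (f : S -> T) (g : T -> U) :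
  continuous f -> continuous g -> continuous (fun s => g (f s)).
Proof. by move=> cf cg s; apply: (continuous_comp (cf s)); exact: cg. Qed.

Lemma continuous_pair (S T U : topologicalType) (f : S -> T) (g : S -> U) :
  continuous f -> continuous g -> continuous (fun s => (f s, g s)).
Proof.
move=> cf cg s.
by apply: (@cvg_pair _ _ _ _ (nbhs (f s)) (nbhs (g s))); [exact: cf|exact: cg].
Qed.

Lemma continuous_slice (S T : topologicalType) (t : S) :
  continuous (fun s : T => (t, s)).
Proof. by apply: continuous_pair => s; [exact: cvg_cst|exact: cvg_id]. Qed.

Lemma shift_continuous (R : realType) (V : normedModType R) (c : V) :
  continuous (fun y : V => y + c).
Proof. by move=> y; apply: cvgD; [exact: cvg_id|exact: cvg_cst]. Qed.

Section Reparametrization.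
Context (R : realType) (V : normedModType R).

(** For [L] at least 0 it is 0 on the boundary of the unit cube with centre [c]
    and outside of it, and [L] on the concentric cube of half the size. *)
Definition plateau (L : R) (c u : V) : R :=
  Num.min L (Num.max 0 (4 * L * (2^-1 - `|u - c|))).

Lemma plateau_continuous L c : continuous (plateau L c).
Proof.
move=> u; apply: (@continuous_min R V (fun=> L)); first exact: cvg_cst.
apply: (@continuous_max R V (fun=> 0)); first exact: cvg_cst.
apply: cvgM; first exact: cvg_cst.
apply: cvgB; first exact: cvg_cst.
by apply: cvg_norm; apply: cvgB; [exact: cvg_id|exact: cvg_cst].
Qed.

Lemma zoom_continuous c :
  continuous (fun z : R * V => (1 + 3 * clamp01 z.1) *: (z.2 - c)).
Proof.
move=> z; apply: cvgZ; last by apply: cvgB; [exact: cvg_snd|exact: cvg_cst].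
apply: cvgD; first exact: cvg_cst.
apply: cvgM; first exact: cvg_cst.
by apply: (@continuous_comp _ _ _ fst (@clamp01 R)); [exact: cvg_fst|exact: clamp01_continuous].
Qed.

Lemma ramp_continuous (t0 : R) (M : V -> R) : continuous M ->
  continuous (fun z : R * V => t0 + Num.min (Num.max 0 (z.1 - 1)) (M z.2)).
Proof.
move=> cM z; apply: cvgD; first exact: cvg_cst.
apply: (@continuous_min R (R * V)%type (fun z => Num.max 0 (z.1 - 1))
  (fun z => M z.2)).
  apply: (@continuous_max R (R * V)%type (fun=> 0)); first exact: cvg_cst.
  by apply: cvgB; [exact: cvg_fst|exact: cvg_cst].
by apply: (@continuous_comp _ _ _ snd M); [exact: cvg_snd|exact: cM].
Qed.

Lemma fade_continuous (t0 : R) (M : V -> R) : continuous M ->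
  continuous (fun z : R * V => t0 + M z.2 * clamp01 (1 - z.1)).
Proof.
move=> cM z; apply: cvgD; first exact: cvg_cst.
apply: cvgM.
  by apply: (@continuous_comp _ _ _ snd M); [exact: cvg_snd|exact: cM].
apply: (@continuous_comp _ _ _ (fun z : R * V => 1 - z.1) (@clamp01 R)).
  by apply: cvgB; [exact: cvg_cst|exact: cvg_fst].
exact: clamp01_continuous.
Qed.

End Reparametrization.

Section Complement.
Context (R : realType) (d : Order.disp_t) (X : finPOrderType d) (a : X).
Local Notation leX := (fun x y : X => (x <= y)%O : Prop).
Local Notation Xa := (set_type ([set~ a] : set (fin_space X))).

Let leX_trans (u v w : X) : (u <= v)%O -> (v <= w)%O -> (u <= w)%O.
Proof. exact: le_trans. Qed.

Definition avoid (v : X) (va : v <> a) : Xa := exist _ v (mem_set va).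

Lemma set_val_neq (x : Xa) : (set_val x : X) <> a.
Proof. exact: (set_valP x). Qed.

Lemma set_val_inj (x y : Xa) : set_val x = set_val y :> X -> x = y.
Proof. exact: val_inj. Qed.

Section Cubes.
Context (n : nat) (x0 : Xa).
Local Notation V := 'rV[R]_n.

Definition outside : set V := [set u | exists i, u ord0 i <= 0 \/ 1 <= u ord0 i].

(** The condition on the tracks of a homotopy relative to the boundary. *)
Definition rel_boundary (u : V) : set X :=
  [set v | v <> a /\ (outside u -> v = set_val x0)].

(** A map defined on the cube extends to the whole space by clamping
    coordinates; the extension has constant value outside of the open cube. *)
Definition cube_ext (f : V -> Xa) (u : V) : X := set_val (f (clamp_cube u)).

Lemma cube_ext_cont f : cube_map x0 f -> lower_cont leX (cube_ext f).
Proof.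
move=> [cf _]; apply: (continuous_lower_cont (f := f \o @clamp_cube R n)).
apply: within_continuous_comp_in cf; first exact: clamp_cube_continuous.
exact: clamp_cube_in.
Qed.

Lemma cube_ext_rel f u : cube_map x0 f -> rel_boundary u (cube_ext f u).
Proof.
move=> [_ f0]; split; first exact: set_val_neq.
move=> [i ui]; rewrite /cube_ext f0//; split; first exact: clamp_cube_in.
exists i; rewrite mxE; case: ui => ui; [left|right].
  exact: clamp01_le0.
exact: clamp01_ge1.
Qed.

Lemma homotopic_cube_homotopic f g : cube_map x0 f -> cube_map x0 g ->
  homotopic R leX rel_boundary (cube_ext f) (cube_ext g) ->
  cube_homotopic x0 f g.
Proof.
move=> mf mg [F [t0 [t1 [cF KF F0 F1]]]].
pose tau (z : R * V) : R * V := ((t1 - t0) * z.1 + t0, z.2).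
have Fa z : F (tau z) <> a by have [] := KF (tau z).
exists (fun z => avoid (Fa z)); split.
- apply: continuous_subspaceT; apply: lower_cont_continuous.
  exact: (lower_cont_comp (@continuous_fst_affine _ _ _ _) cF).
- move=> u uI; apply: set_val_inj; change (F (tau (0, u)) = set_val (f u)).
  rewrite /tau /= F0.
    by rewrite /cube_ext clamp_cube_id.
  by rewrite mulr0 add0r.
- move=> u uI; apply: set_val_inj; change (F (tau (1, u)) = set_val (g u)).
  rewrite /tau /= F1.
    by rewrite /cube_ext clamp_cube_id.
  by rewrite mulr1 subrK.
- move=> t u _ [uI [i ui]]; apply: set_val_inj.
  change (F (tau (t, u)) = set_val x0); have [_ ->//] := KF (tau (t, u)).
  by exists i; case: ui => ->; [left|right].
Qed.

Hypothesis n_gt0 : (0 < n)%N.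
Hypothesis null : sphere_null R leX (sphere V) [set~ a].

Let center : V := const_mx 2^-1.

Lemma outside_center u : outside u -> 2^-1 <= `|u - center|.
Proof.
move=> [i ui]; apply: le_trans (ler_coord_norm _ i).
by rewrite !mxE ler_normr; apply/orP; case: ui => ui; [right|left]; lra.
Qed.

Lemma center_outside y : 2^-1 <= `|y| -> outside (y + center).
Proof.
move=> y2; apply: contrapT => no; move: y2; apply/negP; rewrite -ltNge.
rewrite [ltLHS]/Num.Def.normr /= mx_normrE.
apply: bigmax_lt => [|[j i] _ /=]; first by rewrite invr_gt0.
rewrite (ord1 j) {j}.
rewrite ltr_norml; apply/andP; split.
  rewrite ltNge; apply/negP => yi; apply: no; exists i; left.
  by rewrite !mxE; lra.
rewrite ltNge; apply/negP => yi; apply: no; exists i; right.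
by rewrite !mxE; lra.
Qed.

(** A free null-homotopy [F] becomes one relative to the boundary by retracing
    the path [gam] of the collapsed point. While the cube is magnified until
    its inner half covers the unit ball, time remains at [t0]; then time
    advances to [t0 + M u], which leaves the boundary fixed and leads to [q] on
    the inner half. What is left depends on [gam] only and is contracted along
    [gam]. *)
Lemma cube_map_null f : cube_map x0 f ->
  homotopic R leX rel_boundary (cube_ext f) (fun=> set_val x0).
Proof.
move=> mf; have cf := cube_ext_cont mf.
have cc : continuous (fun y : V => y + center) by exact: shift_continuous.
pose f' (y : V) : X := cube_ext f (y + center).
have f'0 y : 2^-1 <= `|y| -> f' y = set_val x0.
  by move=> /center_outside yo; have [_] := cube_ext_rel (y + center) mf; exact.
have cf' : lower_cont leX (f' : sphere V -> X).
  apply/lower_cont_sphere; split; first exact: (lower_cont_comp cc cf).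
  move=> x x1; exists 2^-1; first by lra.
  by move=> y y2; rewrite !f'0 ?lexx//; lra.
have [q qa [F [t0 [t1' [cF KF F0 F1']]]]] : exists2 q, q <> a &
    homotopic R leX (fun=> [set~ a]) (f' : sphere V -> X) (fun=> q).
  by apply: null => // s; exact: set_val_neq.
pose t1 := Num.max t1' (t0 + 1).
have t01 : t0 + 1 <= t1 by rewrite /t1 le_max lexx orbT.
have F1 t x : t1 <= t -> F (t, x) = q.
  by move=> tt; apply: F1'; rewrite (le_trans _ tt)// /t1 le_max lexx.
pose v : V := const_mx 1.
have v1 : 1 <= `|v|.
  have := ler_coord_norm v (Ordinal n_gt0).
  by rewrite mxE normr1.
pose gam t := F (t, v).
have Fgam t (y : V) : 1 <= `|y| -> F (t, y) = gam t.
  move=> y1; apply: (@sphere_lower_cont_out _ _ _ _ (fun s => F (t, s))) => //.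
  exact: (lower_cont_comp (@continuous_slice _ (sphere V) t) cF).
have cFV (S : topologicalType) (t : S -> R) (y : S -> V) :
    continuous t -> continuous y -> lower_cont leX (fun s => F (t s, y s)).
  move=> ct cy; apply: (lower_cont_comp _ cF).
  apply: continuous_pair ct _.
  exact: (comp_continuous cy (@to_sphere_continuous _ _)).
pose L := t1 - t0.
have L1 : 1 <= L by rewrite /L; lra.
pose M := plateau L center.
have cM : continuous M by exact: plateau_continuous.
have M_ge0 u : 0 <= M u.
  by rewrite /M/plateau le_min le_max lexx /=; lra.
have M_leL u : M u <= L by rewrite /M/plateau ge_min lexx.
have M_out u : outside u -> M u = 0.
  move=> /outside_center uc; rewrite /M/plateau max_l ?min_r//; first lra.
  by rewrite mulr_ge0_le0//; lra.
have M_in u : `|u - center| <= 4^-1 -> M u = L.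
  move=> uc; rewrite /M/plateau min_l// le_max; apply/orP; right.
  by rewrite mulrAC ler_peMl//; lra.
pose m (z : R * V) := Num.min (Num.max 0 (z.1 - 1)) (M z.2).
pose sig (z : R * V) := 1 + 3 * clamp01 z.1.
have sig1 z : 1 <= sig z.
  by rewrite /sig; have := clamp01_ge0 z.1; lra.
apply: (@homotopic_trans _ _ _ _ _ _ (fun u => gam (t0 + M u))).
  exists (fun z => F (t0 + m z, sig z *: (z.2 - center))), 0, (1 + L); split.
  - by apply: cFV; [exact: ramp_continuous|exact: zoom_continuous].
  - move=> z; split; first exact: KF.
    move=> zo; rewrite F0 ?f'0//.
      rewrite normrZ ger0_norm; last by have := sig1 z; lra.
      have := outside_center zo; have := sig1 z => s1 z2.
      by rewrite (le_trans z2)// ler_peMl.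
    rewrite /m M_out// min_r ?addr0//.
    by rewrite le_max lexx.
  - move=> t u tt; rewrite /m /= max_l; last lra.
    rewrite min_l// addr0 F0// /sig clamp01_le0// mulr0 addr0 scale1r.
    by rewrite /f' subrK.
  - move=> t u tt; rewrite /m /= max_r; last lra.
    rewrite min_r; last by have := M_leL u; lra.
    rewrite /sig /= clamp01_ge1; last lra.
    have [uc|uc] := leP `|u - center| 4^-1.
      by rewrite M_in// /gam !F1// /L; lra.
    apply: Fgam; rewrite normrZ ger0_norm; last lra.
    by move: uc; lra.
pose k (z : R * V) := t0 + M z.2 * clamp01 (1 - z.1).
exists (fun z => F (k z, v)), 0, 1; split.
- by apply: cFV; [exact: fade_continuous|move=> z; exact: cvg_cst].
- move=> z; split; first exact: KF.
  by move=> zo; rewrite /k M_out// mul0r addr0 F0// f'0//; lra.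
- by move=> t u tt; rewrite /k /= clamp01_ge1 ?mulr1//; lra.
- move=> t u tt; rewrite /k /= clamp01_le0; last lra.
  by rewrite mulr0 addr0 F0// f'0//; lra.
Qed.

Lemma sphere_null_homotopy_group : trivial_homotopy_group R n x0.
Proof.
have all_eq (f g : V -> Xa) : cube_map x0 f -> cube_map x0 g ->
    cube_homotopic x0 f g.
  move=> mf mg; apply: homotopic_cube_homotopic => //.
  apply: homotopic_trans (cube_map_null mf) _.
  exact/homotopic_sym/cube_map_null.
have m0 : cube_map x0 (cst x0 : V -> Xa).
  by split=> //; apply: continuous_subspaceT; exact: cst_continuous.
have cl (f : V -> Xa) : cube_map x0 f ->
    homotopy_class x0 f = homotopy_class x0 (cst x0).
  move=> mf; apply/seteqP; split=> g [mg _]; split=> //; exact: all_eq.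
apply/seteqP; split=> [_ [f mf <-]|_ ->]; first exact: cl.
by exists (cst x0).
Qed.

End Cubes.

(** Comparable points are joined by a path, so the points reached from [x] form
    an up-set and a down-set. *)
Lemma connected_path_connected :
  connected ([set~ a] : set (fin_space X)) -> path_connected R Xa.
Proof.
move=> conn x y.
pose reach (u v : X) := homotopic R leX (fun _ : R => [set~ a])
  (fun=> u) (fun=> v).
have reach_le u v : u <> a -> v <> a -> (u <= v)%O -> reach u v.
  move=> ua va uv; apply: homotopic_le => //.
  - exact: lower_cont_cst.
  - exact: lower_cont_cst.
have xa := @set_val_neq x; have ya := @set_val_neq y.
pose B := [set v : fin_space X | v <> a /\ reach (set_val x) v].
have BE : B = [set~ a].
  apply: conn.
  - by exists (set_val x); split=> //; exact: reach_le.
  - exists [set u : fin_space X | exists v : X,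
      [/\ v <> a, reach (set_val x) v & (u <= v)%O]].
      move=> u w uw [v [va xv wv]]; exists v; split=> //.
      exact: le_trans uw wv.
    apply/seteqP; split=> [u [ua xu]|u [ua [v [va xv uv]]]].
      by split=> //; exists u.
    split=> //; apply: homotopic_trans xv _.
    by apply: homotopic_sym; exact: reach_le.
  - exists (~` [set u : fin_space X | exists v : X,
      [/\ v <> a, ~ reach (set_val x) v & (u <= v)%O]]).
      refine (open_closedC _); move=> u w uw [v [va xv wv]]; exists v.
      split=> //.
      exact: le_trans uw wv.
    apply/seteqP; split=> [u [ua xu]|u [ua nu]].
      split=> // -[v [va nxv uv]]; apply: nxv; apply: homotopic_trans xu _.
      exact: reach_le.
    split=> //; apply: contrapT => nxu; apply: nu.
    by exists u.
have [_ [F [t0 [t1 [cF KF F0 F1]]]]] : B (set_val y) by rewrite BE.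
pose tau (t : R) : R * R := ((t1 - t0) * t + t0, 0).
have Fa t : F (tau t) <> a by exact: KF.
exists (fun t => avoid (Fa t)); split.
- apply: continuous_subspaceT; apply: lower_cont_continuous.
  apply: (lower_cont_comp _ cF) => t.
  apply: (@cvg_pair _ _ _ _ (nbhs ((t1 - t0) * t + t0)) (nbhs (0 : R))).
    apply: cvgD; last exact: cvg_cst.
    by apply: cvgM; [exact: cvg_cst|exact: cvg_id].
  exact: cvg_cst.
- apply: set_val_inj; change (F (tau 0) = set_val x).
  by rewrite /tau F0// mulr0 add0r.
- apply: set_val_inj; change (F (tau 1) = set_val y).
  by rewrite /tau F1// mulr1 subrK.
Qed.

End Complement.

Lemma height2_no_chain4 d (X : finPOrderType d) (u v m a : X) :
  height X = 2%N -> (u < v)%O -> (v < m)%O -> (m < a)%O -> False.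
Proof.
move=> hX uv vm ma.
have um := lt_trans uv vm; have va := lt_trans vm ma; have ua := lt_trans uv va.
pose C : {set X} := [set x in [:: u; v; m; a]]%SET.
have : (#|C|.-1 <= height X)%N.
  apply: (@leq_bigmax_cond _ _ (fun C : {set X} => #|C|.-1)).
  apply/'forall_implyP => x; rewrite inE => xC.
  apply/'forall_implyP => y.
  rewrite inE => yC; move: xC yC; rewrite !inE.
  move=> /or4P[]/eqP-> /or4P[]/eqP->; rewrite ?comparablexx//;
    by [apply: le_comparable; exact: ltW|apply: ge_comparable; exact: ltW].
have -> : #|C| = 4%N.
  rewrite cardsE; apply/card_uniqP.
  by rewrite /= !inE !negb_or !lt_eqF.
by rewrite hX.
Qed.

Theorem theorem3p5 (R : realType) (d : Order.disp_t) (X : finPOrderType d)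
    (a : X) (hX : height X = 2%N) (hqc : qc_reducible R X)
    (ha : maximal_point a)
    (hconn : connected ([set~ a] : set (fin_space X))) :
  aspherical R (set_type ([set~ a] : set (fin_space X))).
Proof.
split; first exact: connected_path_connected.
move=> n x0 n2; apply: sphere_null_homotopy_group; first exact: ltnW.
pose V : normedModType R := 'rV[R]_n.
(* [X] is taken inside of itself, without extra points. *)
rewrite -(setTD [set a]).
apply: (qc_reducible_link_determines_complement (@sphere_normal R V)
  (@sphere_cylinder_normal R V) hqc (i := id)) => //.
- by move=> u v w; exact: le_trans.
- by move=> v x _ _; exists v.
- by move=> v x _ /(_ v).
apply: graph_sphere_null.
- exact: rV_unit_ball_compact.
- exact: rV_connected_at_infinity.
- move=> u v m _ _ [_ ma] uv vm.
  exact: (height2_no_chain4 hX uv vm (ma m erefl)).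
Qed.
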